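(* $\mathsf{RCA}_0$ proves the following. Let $Q$ be a quasi-order. (i) If $\mathcal{A}(Q)$ is Noetherian, then $\mathcal{U}(Q)$ is Noetherian. (ii) $Q$ is a wqo if and only if $\mathcal{A}(Q)$ is Noetherian.
   Context: $\mathsf{RCA}_0$ is the usual base theory of second-order arithmetic: the axioms of a discretely ordered commutative semiring with identity for $\mathbb{N}$, $\Sigma^0_1$ induction, and $\Delta^0_1$ comprehension. All sets are subsets of $\mathbb{N}$, with the usual coding of pairs and finite sets as numbers. All definitions below are made in $\mathsf{RCA}_0$. A quasi-order is a set $Q$ with a reflexive transitive relation $\leq_Q$. It is a well-quasi-order (wqo) if for every $f\colon\mathbb{N}\to Q$ there are $m<n$ with $f(m)\leq_Q f(n)$. For $q\in Q$, $q{\uparrow}=\{p\in Q:q\leq_Q p\}$; for a finite $\mathbf i\subseteq Q$, $\mathbf i{\downarrow}=\{q\in Q:(\exists p\in\mathbf i)(q\leq_Q p)\}$. $\mathcal{P}_{\mathrm f}(Y)$ is the set of (codes of) finite subsets of $Y$. A countable second-countable space is a triple $(X,(U_i)_{i\in I},k)$ where $X$ is a set, $(U_i)_{i\in I}$ is an indexed sequence of subsets of $X$ and $k\colon X\times I\times I\to I$, such that every $x\in X$ lies in some $U_i$, and if $x\in U_i\cap U_j$ then $x\in U_{k(x,i,j)}\subseteq U_i\cap U_j$. A function $h\colon\mathbb{N}\to\mathcal{P}_{\mathrm f}(I)$ codes the effectively open set $G_h=\bigcup_{n}\bigcup_{i\in h(n)}U_i$ and the effectively closed set $F_h=X\setminus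 G_h$ (''$x\in G_h$'' abbreviates $(\exists n)(\exists i\in h(n))(x\in U_i)$). A sequence of effectively open (closed) sets is coded by $g\colon\mathbb{N}\times\mathbb{N}\to\mathcal{P}_{\mathrm f}(I)$, the $n$-th set being the one coded by $g(n,\cdot)$. The space is Noetherian if for every sequence $(F_n)_{n\in\mathbb{N}}$ of effectively closed sets with $\forall n(F_n\supseteq F_{n+1})$ there is $N$ with $(\forall n>N)(F_n=F_N)$; over $\mathsf{RCA}_0$ this is equivalent to: for every sequence $(G_n)_{n\in\mathbb{N}}$ of effectively open sets with $\forall n(G_n\subseteq G_{n+1})$ there is $N$ with $(\forall n>N)(G_n=G_N)$; and also to: for every effectively open $G_h$ there is $N$ with $G_h=\bigcup_{n<N}\bigcup_{i\in h(n)}U_i$. $\mathcal{A}(Q)$ (Alexandroff topology) is the countable second-countable space $(Q,(U_q)_{q\in Q},k)$ with $U_q=q{\uparrow}$ and $k(q,p,r)=q$. $\mathcal{U}(Q)$ (upper topology) is the countable second-countable space $(Q,(V_{\mathbf i})_{\mathbf i\in\mathcal{P}_{\mathrm f}(Q)},\ell)$ with $V_{\mathbf i}=Q\setminus(\mathbf i{\downarrow})$ and $\ell(q,\mathbf i,\mathbf j)=\mathbf i\cup\mathbf j$. *)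

(* Defs.v *)
From Stdlib Require Import List.
Import ListNotations.

(** * Syntax of second-order arithmetic

    Two-sorted first-order language; number variables and set variables are
    de Bruijn indices in two independent index spaces.  The only set terms are
    set variables.  Equality is primitive for numbers only. *)

Inductive term : Type :=
| tvar (n : nat)
| tzero
| tone
| tadd (s t : term)
| tmul (s t : term).

Inductive form : Type :=
| fbot
| feq (s t : term)
| flt (s t : term)
| fmem (t : term) (X : nat)
| fimp (a b : form)
| fall1 (a : form)   (* quantifier over numbers *)
| fall2 (a : form).  (* quantifier over sets *)

(** The logic is classical, so the other connectives are abbreviations. *)

Definition fneg (a : form) : form := fimp a fbot.
Definition fand (a b : form) : form := fneg (fimp a (fneg b)).
Definition for_ (a b : form) : form := fimp (fneg a) b.
Definition fiff (a b : form) : form := fand (fimp a b) (fimp b a).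
Definition fex1 (a : form) : form := fneg (fall1 (fneg a)).
Definition fex2 (a : form) : form := fneg (fall2 (fneg a)).

(** Simultaneous substitution: terms for number variables, set variables for
    set variables. *)

Fixpoint tsubst (sigma : nat -> term) (t : term) : term :=
  match t with
  | tvar n => sigma n
  | tzero => tzero
  | tone => tone
  | tadd s t => tadd (tsubst sigma s) (tsubst sigma t)
  | tmul s t => tmul (tsubst sigma s) (tsubst sigma t)
  end.

Definition tshift : term -> term := tsubst (fun n => tvar (S n)).

Definition scons {A : Type} (a : A) (f : nat -> A) (n : nat) : A :=
  match n with 0 => a | S m => f m end.

Definition up1 (sigma : nat -> term) : nat -> term :=
  scons (tvar 0) (fun n => tshift (sigma n)).

Definition up2 (rho : nat -> nat) : nat -> nat :=
  scons 0 (fun X => S (rho X)).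

Fixpoint fsubst (sigma : nat -> term) (rho : nat -> nat) (a : form) : form :=
  match a with
  | fbot => fbot
  | feq s t => feq (tsubst sigma s) (tsubst sigma t)
  | flt s t => flt (tsubst sigma s) (tsubst sigma t)
  | fmem t X => fmem (tsubst sigma t) (rho X)
  | fimp a b => fimp (fsubst sigma rho a) (fsubst sigma rho b)
  | fall1 a => fall1 (fsubst (up1 sigma) rho a)
  | fall2 a => fall2 (fsubst sigma (up2 rho) a)
  end.

Definition shift1 : form -> form := fsubst (fun n => tvar (S n)) (fun X => X).
Definition shift2 : form -> form := fsubst tvar S.
Definition inst1 (a : form) (t : term) : form :=
  fsubst (scons t tvar) (fun X => X) a.
Definition inst2 (a : form) (X : nat) : form :=
  fsubst tvar (scons X (fun Y => Y)) a.

(** * Provability: classical natural deduction with equality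

    The formulas of [T] are available in every context; since the context need
    not mention their free variables, an open axiom has the force of its
    universal closure. *)

Inductive prf (T : form -> Prop) : list form -> form -> Prop :=
| prf_ax G a : T a -> prf T G a
| prf_hyp G a : In a G -> prf T G a
| prf_imp_intro G a b : prf T (a :: G) b -> prf T G (fimp a b)
| prf_imp_elim G a b : prf T G (fimp a b) -> prf T G a -> prf T G b
| prf_contradiction G a : prf T (fneg a :: G) fbot -> prf T G a
| prf_all1_intro G a : prf T (map shift1 G) a -> prf T G (fall1 a)
| prf_all1_elim G a t : prf T G (fall1 a) -> prf T G (inst1 a t)
| prf_all2_intro G a : prf T (map shift2 G) a -> prf T G (fall2 a)
| prf_all2_elim G a X : prf T G (fall2 a) -> prf T G (inst2 a X)
| prf_eq_refl G t : prf T G (feq t t)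
| prf_eq_subst G a s t :
    prf T G (feq s t) -> prf T G (inst1 a s) -> prf T G (inst1 a t).

Definition proves (T : form -> Prop) (a : form) : Prop := prf T [] a.

(** * Named-variable notation for formulas

    An expression is a function of the number [d] of number quantifiers and the
    number [e] of set quantifiers above it.  A variable whose binder sits at
    depth [d] is the function sending a depth [d'] to the index [d' - S d], so
    that formulas can be written with Coq-bound variables.  Evaluating a closed
    expression at depths [0 0] gives a sentence. *)

Definition num : Type := nat -> term.
Definition set : Type := nat -> nat.
Definition fm : Type := nat -> nat -> form.

Definition sentence (A : fm) : form := A 0 0.

Definition Zero : num := fun _ => tzero.
Definition One : num := fun _ => tone.
Definition Add (s t : num) : num := fun d => tadd (s d) (t d).
Definition Mul (s t : num) : num := fun d => tmul (s d) (t d).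

Definition Eq (s t : num) : fm := fun d _ => feq (s d) (t d).
Definition Lt (s t : num) : fm := fun d _ => flt (s d) (t d).
Definition Mem (t : num) (X : set) : fm := fun d e => fmem (t d) (X e).
Definition Not (A : fm) : fm := fun d e => fneg (A d e).
Definition Imp (A B : fm) : fm := fun d e => fimp (A d e) (B d e).
Definition And (A B : fm) : fm := fun d e => fand (A d e) (B d e).
Definition Or (A B : fm) : fm := fun d e => for_ (A d e) (B d e).
Definition Iff (A B : fm) : fm := fun d e => fiff (A d e) (B d e).

Definition bound (d : nat) : num := fun d' => tvar (d' - S d).
Definition sbound (e : nat) : set := fun e' => e' - S e.

Definition All (A : num -> fm) : fm := fun d e => fall1 (A (bound d) (S d) e).
Definition Ex (A : num -> fm) : fm := fun d e => fex1 (A (bound d) (S d) e).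
Definition AllS (A : set -> fm) : fm := fun d e => fall2 (A (sbound e) d (S e)).
Definition ExS (A : set -> fm) : fm := fun d e => fex2 (A (sbound e) d (S e)).

Declare Scope so_scope.
Delimit Scope so_scope with so.
Notation "s + t" := (Add s t) : so_scope.
Notation "s * t" := (Mul s t) : so_scope.
Notation "s = t" := (Eq s t) : so_scope.
Notation "s < t" := (Lt s t) : so_scope.
Notation "s <= t" := (Or (Lt s t) (Eq s t)) : so_scope.
Notation "t \in X" := (Mem t X) (at level 70, no associativity) : so_scope.
Notation "~ A" := (Not A) : so_scope.
Notation "A /\ B" := (And A B) : so_scope.
Notation "A \/ B" := (Or A B) : so_scope.
Notation "A --> B" := (Imp A B)
  (at level 90, right associativity) : so_scope.
Notation "A <--> B" := (Iff A B)
  (at level 95, no associativity) : so_scope.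
Notation "'ALL' x .. y , A" := (All (fun x => .. (All (fun y => A%so)) ..))
  (at level 200, x binder, y binder, right associativity) : so_scope.
Notation "'EX' x .. y , A" := (Ex (fun x => .. (Ex (fun y => A%so)) ..))
  (at level 200, x binder, y binder, right associativity) : so_scope.
Notation "'ALLS' X .. Y , A" := (AllS (fun X => .. (AllS (fun Y => A%so)) ..))
  (at level 200, X binder, Y binder, right associativity) : so_scope.
Notation "'EXS' X .. Y , A" := (ExS (fun X => .. (ExS (fun Y => A%so)) ..))
  (at level 200, X binder, Y binder, right associativity) : so_scope.

(** * The theory RCA_0 *)

(** Discretely ordered commutative semirings with identity. *)

Inductive semiring_axiom : form -> Prop :=
| ax_addA : semiring_axiom (sentence (ALL x y z, (x + y) + z = x + (y + z))%so)
| ax_addC : semiring_axiom (sentence (ALL x y, x + y = y + x)%so)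
| ax_mulA : semiring_axiom (sentence (ALL x y z, (x * y) * z = x * (y * z))%so)
| ax_mulC : semiring_axiom (sentence (ALL x y, x * y = y * x)%so)
| ax_mulDr :
    semiring_axiom (sentence (ALL x y z, x * (y + z) = x * y + x * z)%so)
| ax_add0 : semiring_axiom (sentence (ALL x, x + Zero = x)%so)
| ax_mul0 : semiring_axiom (sentence (ALL x, x * Zero = Zero)%so)
| ax_mul1 : semiring_axiom (sentence (ALL x, x * One = x)%so)
| ax_lt_trans :
    semiring_axiom (sentence (ALL x y z, x < y /\ y < z --> x < z)%so)
| ax_lt_irrefl : semiring_axiom (sentence (ALL x, ~ x < x)%so)
| ax_lt_total :
    semiring_axiom (sentence (ALL x y, x < y \/ x = y \/ y < x)%so)
| ax_lt_add :
    semiring_axiom (sentence (ALL x y z, x < y --> x + z < y + z)%so)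
| ax_lt_mul :
    semiring_axiom
      (sentence (ALL x y z, Zero < z /\ x < y --> x * z < y * z)%so)
| ax_lt_diff :
    semiring_axiom (sentence (ALL x y, x < y --> EX z, x + z = y)%so)
| ax_lt01 : semiring_axiom (sentence (Zero < One)%so)
| ax_discrete :
    semiring_axiom (sentence (ALL x, Zero < x --> One <= x)%so)
| ax_le0 : semiring_axiom (sentence (ALL x, Zero <= x)%so).

(** Bounded-quantifier formulas, possibly with number and set parameters.  The
    bound of a bounded quantifier does not contain the quantified variable. *)

Inductive bounded : form -> Prop :=
| bounded_bot : bounded fbot
| bounded_eq s t : bounded (feq s t)
| bounded_lt s t : bounded (flt s t)
| bounded_mem t X : bounded (fmem t X)
| bounded_imp a b : bounded a -> bounded b -> bounded (fimp a b)
| bounded_all t a :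
    bounded a -> bounded (fall1 (fimp (flt (tvar 0) (tshift t)) a))
| bounded_ex t a :
    bounded a -> bounded (fex1 (fand (flt (tvar 0) (tshift t)) a)).

Inductive Sigma1 : form -> Prop :=
| Sigma1_intro a : bounded a -> Sigma1 (fex1 a).

Inductive Pi1 : form -> Prop :=
| Pi1_intro a : bounded a -> Pi1 (fall1 a).

(** [a] is seen as a property of the number variable [0]. *)
Definition induction (a : form) : form :=
  let succ := scons (tadd (tvar 0) tone) (fun n => tvar (S n)) in
  fimp (fand (inst1 a tzero) (fall1 (fimp a (fsubst succ (fun X => X) a))))
    (fall1 a).

(** [shift2] ensures that the set being defined does not occur in [a]. *)
Definition comprehension (a b : form) : form :=
  fimp (fall1 (fiff a b))
    (fex2 (fall1 (fiff (fmem (tvar 0) 0) (shift2 a)))).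

Inductive RCA0 : form -> Prop :=
| RCA0_semiring a : semiring_axiom a -> RCA0 a
| RCA0_induction a : Sigma1 a -> RCA0 (induction a)
| RCA0_comprehension a b :
    Sigma1 a -> Pi1 b -> RCA0 (comprehension a b).

(** * Coding *)

Local Open Scope so_scope.

Definition pair (s t : num) : num := (s + t) * (s + t) + s.
Notation "<< s , t >>" := (pair s t) (at level 0) : so_scope.

(** [<<k, <<m, n>>>>] represents the finite set of all [i < k] such that
    [m (i + 1) + 1] divides [n]; the code of a finite set is its least
    representative (Simpson, Subsystems of Second Order Arithmetic, II.2). *)

Definition fin_rep (c : num) : fm := EX k m n, c = <<k, <<m, n>>>>.

Definition in_fin (i c : num) : fm :=
  EX k m n, c = <<k, <<m, n>>>> /\ i < k /\
    EX d, n = (m * (i + One) + One) * d.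

Definition fin_code (c : num) : fm :=
  fin_rep c /\
  ALL b, b < c --> fin_rep b --> ~ (ALL i, in_fin i b <--> in_fin i c).

Definition Pfin (Y : set) (c : num) : fm :=
  fin_code c /\ ALL i, in_fin i c --> i \in Y.

(** [f] is a function from the class [D] to the class [C]. *)

Definition func (D C : num -> fm) (f : set) : fm :=
  (ALL z, z \in f --> EX x y, D x /\ C y /\ z = <<x, y>>) /\
  (ALL x, D x --> EX y, <<x, y>> \in f /\
     ALL w, <<x, w>> \in f --> w = y).

Definition nats (_ : num) : fm := Zero = Zero.
Definition elements (X : set) (x : num) : fm := x \in X.
Definition nat_pairs (z : num) : fm := EX n m, z = <<n, m>>.

(** * Quasi-orders *)

Definition quasi_order (Q le : set) : fm :=
  (ALL z, z \in le --> EX p q, p \in Q /\ q \in Q /\ z = <<p, q>>) /\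
  (ALL q, q \in Q --> <<q, q>> \in le) /\
  (ALL p q r, <<p, q>> \in le /\ <<q, r>> \in le --> <<p, r>> \in le).

Definition wqo (Q le : set) : fm :=
  quasi_order Q le /\
  ALLS f, func nats (elements Q) f -->
    EX m n, m < n /\
      EX p q, <<m, p>> \in f /\ <<n, q>> \in f /\ <<p, q>> \in le.

(** * Countable second-countable spaces

    The indexed family [(U_i)] is the set [U] of all [<<i, x>>] with
    [x] in [U_i]. *)

Definition csc_space (X I U k : set) : fm :=
  (ALL z, z \in U --> EX i x, i \in I /\ x \in X /\ z = <<i, x>>) /\
  func (fun z => EX x i j, x \in X /\ i \in I /\ j \in I /\
                   z = <<x, <<i, j>>>>) (elements I) k /\
  (ALL x, x \in X --> EX i, i \in I /\ <<i, x>> \in U) /\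
  (ALL x i j, <<i, x>> \in U /\ <<j, x>> \in U -->
     EX m, <<<<x, <<i, j>>>>, m>> \in k /\ <<m, x>> \in U /\
       ALL y, <<m, y>> \in U --> <<i, y>> \in U /\ <<j, y>> \in U).

(** Membership in the [n]-th effectively open and the [n]-th effectively closed
    set coded by [g]. *)

Definition in_open (U g : set) (n x : num) : fm :=
  EX m c, <<<<n, m>>, c>> \in g /\ EX i, in_fin i c /\ <<i, x>> \in U.

Definition in_closed (X U g : set) (n x : num) : fm :=
  x \in X /\ ~ in_open U g n x.

Definition noetherian (X I U k : set) : fm :=
  csc_space X I U k /\
  ALLS g, func nat_pairs (Pfin I) g -->
    (ALL n x, in_closed X U g (n + One) x --> in_closed X U g n x) -->
    EX N, ALL n, N < n -->
      ALL x, in_closed X U g n x <--> in_closed X U g N x.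

(** The Alexandroff space of [Q] is [(Q, U, k)], with [U] indexed by [Q]. *)

Definition alexandroff (Q le U k : set) : fm :=
  (ALL z, z \in U <-->
     EX q p, q \in Q /\ p \in Q /\ <<q, p>> \in le /\ z = <<q, p>>) /\
  (ALL z, z \in k <-->
     EX q p r, q \in Q /\ p \in Q /\ r \in Q /\ z = <<<<q, <<p, r>>>>, q>>).

Definition down (Q le : set) (i q : num) : fm :=
  q \in Q /\ EX p, in_fin p i /\ <<q, p>> \in le.

(** The upper space of [Q] is [(Q, V, l)], with [V] indexed by [I]. *)

Definition upper (Q le I V l : set) : fm :=
  (ALL i, i \in I <--> Pfin Q i) /\
  (ALL z, z \in V <-->
     EX i q, i \in I /\ q \in Q /\ ~ down Q le i q /\ z = <<i, q>>) /\
  (ALL z, z \in l <-->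
     EX q i j u, q \in Q /\ i \in I /\ j \in I /\ fin_code u /\
       (ALL p, in_fin p u <--> in_fin p i \/ in_fin p j) /\
       z = <<<<q, <<i, j>>>>, u>>).

Definition A_noetherian (Q le : set) : fm :=
  EXS U k, alexandroff Q le U k /\ noetherian Q Q U k.

Definition U_noetherian (Q le : set) : fm :=
  EXS I V l, upper Q le I V l /\ noetherian Q I V l.

(* Main.v *)
From Stdlib Require Import List Arith Lia Cantor Ring.
From Stdlib Require Import ClassicalEpsilon FunctionalExtensionality
  ProofIrrelevance PropExtensionality.
Require Import Defs.
Import ListNotations.

(** Derivability in RCA0 is reduced to truth in all of its models by Goedel's
    completeness theorem ([completeness]), after which the statement is proved
    inside an arbitrary model [M], whose numbers may be nonstandard and whose
    sets are whatever its second sort provides.  Completeness is shown by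
    Henkin's construction: a consistent context is extended to a complete theory
    with witnesses, and terms modulo provable equality form a model of it.

    Inside a model, induction and comprehension are available only for predicates
    given by formulas.  [B0] is the class of predicates defined by bounded
    formulas with parameters; its closure lemmas, run by the tactic [b0], replace
    the writing of formulas, and [sigma1_induction] and [delta1_comprehension]
    are the two axiom schemes expressed with it.  The arithmetic that is needed
    concerns the coding of finite sets by divisibility: the moduli
    [m * (i + 1) + 1] for [i < k] are pairwise coprime when [m] is a multiple of
    [1, ..., k], so that every bounded predicate restricted to [i < k] has a code
    ([fin_code_exists]).  Finite codes in turn allow every unbounded decidable set
    to be enumerated in increasing order ([increasing_enumeration]).

    The mathematical core is then short.  Let [Q] be a wqo and let an increasing
    sequence of open sets of the Alexandroff topology be given.  List all
    elements [q] whose cones [U_q] occur in the code, and keep those that are not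
    above any element listed earlier.  If infinitely many were kept, their
    enumeration would be a bad sequence; so finitely many are kept, they all
    occur in one set of the sequence, and that set contains all others
    ([wqo_alexandroff_noetherian]).  Conversely, for [f] from the numbers to [Q]
    the upward closures of [f 0, ..., f n] are open sets which stabilise only if
    [f] is not bad ([alexandroff_noetherian_wqo]).  Finally, open sets of the upper
    topology are upward closed, and each is the union of decidable stages;
    these stages are open sets of the Alexandroff topology, which stabilise if that
    topology is Noetherian ([alexandroff_upper_noetherian]). *)


(** * Substitution *)

Lemma tsubst_tsubst sigma tau t :
  tsubst tau (tsubst sigma t) = tsubst (fun n => tsubst tau (sigma n)) t.
Proof. induction t; simpl; congruence. Qed.

Lemma tsubst_tvar t : tsubst tvar t = t.
Proof. induction t; simpl; congruence. Qed.

Lemma up1_comp sigma tau :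
  (fun n => tsubst (up1 tau) (up1 sigma n)) = up1 (fun n => tsubst tau (sigma n)).
Proof.
  extensionality n; destruct n as [|n]; [reflexivity|].
  cbn; unfold tshift; rewrite !tsubst_tsubst; reflexivity.
Qed.

Lemma up2_comp rho pi : (fun X => up2 pi (up2 rho X)) = up2 (fun X => pi (rho X)).
Proof. extensionality X; destruct X; reflexivity. Qed.

Lemma fsubst_fsubst sigma rho tau pi a :
  fsubst tau pi (fsubst sigma rho a) =
  fsubst (fun n => tsubst tau (sigma n)) (fun X => pi (rho X)) a.
Proof.
  revert sigma rho tau pi; induction a; intros; simpl; f_equal;
    rewrite ?tsubst_tsubst; auto.
  - rewrite IHa, up1_comp; reflexivity.
  - rewrite IHa, up2_comp; reflexivity.
Qed.

Lemma up1_tvar : up1 tvar = tvar.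
Proof. extensionality n; destruct n; reflexivity. Qed.

Lemma up2_id : up2 (fun X => X) = (fun X => X).
Proof. extensionality X; destruct X; reflexivity. Qed.

Lemma fsubst_id a : fsubst tvar (fun X => X) a = a.
Proof.
  induction a; simpl; f_equal; rewrite ?tsubst_tvar, ?up1_tvar, ?up2_id; auto.
Qed.

Lemma fsubst_shift1 sigma rho a :
  shift1 (fsubst sigma rho a) = fsubst (up1 sigma) rho (shift1 a).
Proof. unfold shift1; rewrite !fsubst_fsubst; reflexivity. Qed.

Lemma fsubst_shift2 sigma rho a :
  shift2 (fsubst sigma rho a) = fsubst sigma (up2 rho) (shift2 a).
Proof.
  unfold shift2; rewrite !fsubst_fsubst; f_equal.
  extensionality n; simpl; apply tsubst_tvar.
Qed.

Lemma tsubst_scons_tshift t u : tsubst (scons t tvar) (tshift u) = u.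
Proof. unfold tshift; rewrite tsubst_tsubst; apply tsubst_tvar. Qed.

Lemma scons_up1 sigma t :
  (fun n => tsubst (scons t tvar) (up1 sigma n)) = scons t sigma.
Proof.
  extensionality n; destruct n as [|n]; [reflexivity|].
  apply tsubst_scons_tshift.
Qed.

Lemma inst1_up1 sigma rho a t :
  inst1 (fsubst (up1 sigma) rho a) t = fsubst (scons t sigma) rho a.
Proof. unfold inst1; rewrite fsubst_fsubst, scons_up1; reflexivity. Qed.

Lemma inst2_up2 sigma rho a X :
  inst2 (fsubst sigma (up2 rho) a) X = fsubst sigma (scons X rho) a.
Proof.
  unfold inst2; rewrite fsubst_fsubst; f_equal.
  - extensionality n; apply tsubst_tvar.
  - extensionality Y; destruct Y; reflexivity.
Qed.

Lemma fsubst_inst1 sigma rho a t :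
  fsubst sigma rho (inst1 a t) = inst1 (fsubst (up1 sigma) rho a) (tsubst sigma t).
Proof.
  rewrite inst1_up1; unfold inst1; rewrite fsubst_fsubst; f_equal.
  extensionality n; destruct n; reflexivity.
Qed.

Lemma fsubst_inst2 sigma rho a X :
  fsubst sigma rho (inst2 a X) = inst2 (fsubst sigma (up2 rho) a) (rho X).
Proof.
  rewrite inst2_up2; unfold inst2; rewrite fsubst_fsubst; f_equal.
  extensionality Y; destruct Y; reflexivity.
Qed.

(** Fresh variables are found above a bound, so an overestimate is as good as
    the exact set of free variables: variables are counted with their raw index
    below any number of binders, and the two sorts share one bound. *)
Fixpoint tbound (t : term) : nat :=
  match t with
  | tvar n => S n
  | tzero | tone => 0
  | tadd s t | tmul s t => Nat.max (tbound s) (tbound t)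
  end.

Fixpoint fbound (a : form) : nat :=
  match a with
  | fbot => 0
  | feq s t | flt s t => Nat.max (tbound s) (tbound t)
  | fmem t X => Nat.max (tbound t) (S X)
  | fimp a b => Nat.max (fbound a) (fbound b)
  | fall1 a | fall2 a => fbound a
  end.

Lemma tsubst_ext sigma tau t :
  (forall n, n < tbound t -> sigma n = tau n) -> tsubst sigma t = tsubst tau t.
Proof.
  induction t; simpl; intros H; f_equal; auto with arith;
    first [apply IHt1|apply IHt2]; intros; apply H; lia.
Qed.

Lemma fsubst_ext sigma tau rho pi a :
  (forall n, n < fbound a -> sigma n = tau n) ->
  (forall X, X < fbound a -> rho X = pi X) ->
  fsubst sigma rho a = fsubst tau pi a.
Proof.
  revert sigma tau rho pi; induction a; simpl; intros sigma tau rho pi H1 H2;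
    f_equal; try reflexivity;
    try (apply tsubst_ext; intros; apply H1; lia);
    try (apply H2; lia);
    try (first [apply IHa1 | apply IHa2]; intros;
         first [apply H1 | apply H2]; lia).
  - apply IHa; auto.
    intros [|n] Hn; simpl; [reflexivity|f_equal; apply H1; lia].
  - apply IHa; auto.
    intros [|X] HX; simpl; [reflexivity|f_equal; apply H2; lia].
Qed.

(** * Derivations *)

Section Provability.
Variable T : form -> Prop.
Hypothesis T_subst : forall a sigma rho, T a -> T (fsubst sigma rho a).

Lemma prf_subst G a : prf T G a ->
  forall sigma rho, prf T (map (fsubst sigma rho) G) (fsubst sigma rho a).
Proof.
  induction 1 as [G a Ha|G a Ha|G a b _ IH|G a b _ IH1 _ IH2|G a _ IH|G a _ IH
    |G a t _ IH|G a _ IH|G a X _ IH|G t|G a s t _ IH1 _ IH2]; intros sigma rho.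
  - apply prf_ax; auto.
  - apply prf_hyp, in_map, Ha.
  - apply prf_imp_intro, IH.
  - exact (prf_imp_elim _ _ _ _ (IH1 sigma rho) (IH2 sigma rho)).
  - apply prf_contradiction, IH.
  - apply prf_all1_intro.
    specialize (IH (up1 sigma) rho); rewrite map_map in IH |- *.
    erewrite map_ext; [exact IH|]; intros b; apply fsubst_shift1.
  - rewrite fsubst_inst1; apply prf_all1_elim, IH.
  - apply prf_all2_intro.
    specialize (IH sigma (up2 rho)); rewrite map_map in IH |- *.
    erewrite map_ext; [exact IH|]; intros b; apply fsubst_shift2.
  - rewrite fsubst_inst2; apply prf_all2_elim, IH.
  - apply prf_eq_refl.
  - rewrite fsubst_inst1; eapply prf_eq_subst; [apply IH1|].
    rewrite <- fsubst_inst1; apply IH2.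
Qed.

Lemma prf_weaken G a : prf T G a -> forall G', incl G G' -> prf T G' a.
Proof.
  induction 1 as [G a Ha|G a Ha|G a b _ IH|G a b _ IH1 _ IH2|G a _ IH|G a _ IH
    |G a t _ IH|G a _ IH|G a X _ IH|G t|G a s t _ IH1 _ IH2]; intros G' HG.
  - apply prf_ax, Ha.
  - apply prf_hyp, HG, Ha.
  - apply prf_imp_intro, IH, incl_cons; [left; reflexivity|].
    apply incl_tl, HG.
  - eapply prf_imp_elim; eauto.
  - apply prf_contradiction, IH, incl_cons; [left; reflexivity|].
    apply incl_tl, HG.
  - apply prf_all1_intro, IH, incl_map, HG.
  - apply prf_all1_elim; auto.
  - apply prf_all2_intro, IH, incl_map, HG.
  - apply prf_all2_elim; auto.
  - apply prf_eq_refl.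
  - eapply prf_eq_subst; eauto.
Qed.

(** Substituting the variable [0] for a fresh [y], and [n + 1] for any other
    [n], turns the hypotheses into their shifts and the instance into [b]. *)
Lemma prf_all1_fresh G b y :
  (forall c, In c (b :: G) -> fbound c <= y) ->
  prf T G (inst1 b (tvar y)) -> prf T G (fall1 b).
Proof.
  intros Hy H; apply prf_all1_intro.
  set (sigma := fun n => if n =? y then tvar 0 else tvar (S n)).
  apply prf_subst with (sigma := sigma) (rho := fun X => X) in H.
  assert (Hs : forall n, n < y -> sigma n = tvar (S n)).
  { intros n Hn; unfold sigma; destruct (Nat.eqb_spec n y); [lia|reflexivity]. }
  replace (fsubst sigma (fun X => X) (inst1 b (tvar y))) with b in H.
  - replace (map shift1 G) with (map (fsubst sigma (fun X => X)) G); [exact H|].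
    apply map_ext_in; intros c Hc; apply fsubst_ext; [|reflexivity].
    intros n Hn; apply Hs; specialize (Hy c (or_intror Hc)); lia.
  - unfold inst1; rewrite fsubst_fsubst, <- (fsubst_id b) at 1.
    apply fsubst_ext; [|reflexivity].
    specialize (Hy b (or_introl eq_refl)).
    intros [|n] Hn; simpl; [unfold sigma; rewrite Nat.eqb_refl; reflexivity|].
    rewrite Hs; [reflexivity|lia].
Qed.

Lemma prf_all2_fresh G b y :
  (forall c, In c (b :: G) -> fbound c <= y) ->
  prf T G (inst2 b y) -> prf T G (fall2 b).
Proof.
  intros Hy H; apply prf_all2_intro.
  set (rho := fun X => if X =? y then 0 else S X).
  apply prf_subst with (sigma := tvar) (rho := rho) in H.
  assert (Hs : forall X, X < y -> rho X = S X).
  { intros X HX; unfold rho; destruct (Nat.eqb_spec X y); [lia|reflexivity]. }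
  replace (fsubst tvar rho (inst2 b y)) with b in H.
  - replace (map shift2 G) with (map (fsubst tvar rho) G); [exact H|].
    apply map_ext_in; intros c Hc; apply fsubst_ext; [reflexivity|].
    intros X HX; apply Hs; specialize (Hy c (or_intror Hc)); lia.
  - unfold inst2; rewrite fsubst_fsubst, <- (fsubst_id b) at 1.
    apply fsubst_ext; [reflexivity|].
    specialize (Hy b (or_introl eq_refl)).
    intros [|X] HX; simpl; [unfold rho; rewrite Nat.eqb_refl; reflexivity|].
    rewrite Hs; [reflexivity|lia].
Qed.

Lemma prf_explosion G a : prf T G fbot -> prf T G a.
Proof.
  intros H; apply prf_contradiction.
  apply (prf_weaken _ _ H), incl_tl, incl_refl.
Qed.

Lemma prf_neg_elim G a : prf T G (fneg a) -> prf T G a -> prf T G fbot.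
Proof. apply prf_imp_elim. Qed.

Lemma prf_mono_cons G a b : prf T G a -> prf T (b :: G) a.
Proof. intros H; apply (prf_weaken _ _ H), incl_tl, incl_refl. Qed.

Lemma prf_head G a : prf T (a :: G) a.
Proof. apply prf_hyp; left; reflexivity. Qed.

Lemma prf_eq_sym G s t : prf T G (feq s t) -> prf T G (feq t s).
Proof.
  intros H.
  replace (feq t s) with (inst1 (feq (tvar 0) (tshift s)) t).
  - eapply prf_eq_subst; [exact H|].
    cbn; rewrite tsubst_scons_tshift; apply prf_eq_refl.
  - cbn; rewrite tsubst_scons_tshift; reflexivity.
Qed.

End Provability.

Fixpoint tcode (t : term) : nat :=
  match t with
  | tvar n => to_nat (0, n)
  | tzero => to_nat (1, 0)
  | tone => to_nat (2, 0)
  | tadd s t => to_nat (3, to_nat (tcode s, tcode t))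
  | tmul s t => to_nat (4, to_nat (tcode s, tcode t))
  end.

(** Countability of the set of formulas lets a Henkin theory be built in a
    sequence of finite contexts, in which fresh variables always exist. *)
Fixpoint fcode (a : form) : nat :=
  match a with
  | fbot => to_nat (0, 0)
  | feq s t => to_nat (1, to_nat (tcode s, tcode t))
  | flt s t => to_nat (2, to_nat (tcode s, tcode t))
  | fmem t X => to_nat (3, to_nat (tcode t, X))
  | fimp a b => to_nat (4, to_nat (fcode a, fcode b))
  | fall1 a => to_nat (5, fcode a)
  | fall2 a => to_nat (6, fcode a)
  end.

Lemma to_nat_eq m n m' n' : to_nat (m, n) = to_nat (m', n') -> m = m' /\ n = n'.
Proof. intros H; apply to_nat_inj in H; inversion H; auto. Qed.

Ltac split_codes :=
  repeat match goal with
  | H : to_nat _ = to_nat _ |- _ =>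
      apply to_nat_eq in H; destruct H; try discriminate
  end.

Lemma tcode_inj s t : tcode s = tcode t -> s = t.
Proof.
  revert t; induction s; intros t'; destruct t'; cbn [tcode]; intros H;
    split_codes; f_equal; auto.
Qed.

Lemma fcode_inj a b : fcode a = fcode b -> a = b.
Proof.
  revert b; induction a; intros b'; destruct b'; cbn [fcode]; intros H;
    split_codes; f_equal; auto using tcode_inj.
Qed.

(** * Structures *)

Record structure : Type := {
  dom : Type;
  sets : Type;
  szero : dom;
  sone : dom;
  sadd : dom -> dom -> dom;
  smul : dom -> dom -> dom;
  slt : dom -> dom -> Prop;
  smem : dom -> sets -> Prop }.

Section Semantics.
Variable M : structure.

Fixpoint teval (e : nat -> dom M) (t : term) : dom M :=
  match t with
  | tvar n => e n
  | tzero => szero M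
  | tone => sone M
  | tadd s t => sadd M (teval e s) (teval e t)
  | tmul s t => smul M (teval e s) (teval e t)
  end.

Fixpoint sat (e : nat -> dom M) (f : nat -> sets M) (a : form) : Prop :=
  match a with
  | fbot => False
  | feq s t => teval e s = teval e t
  | flt s t => slt M (teval e s) (teval e t)
  | fmem t X => smem M (teval e t) (f X)
  | fimp a b => sat e f a -> sat e f b
  | fall1 a => forall x, sat (scons x e) f a
  | fall2 a => forall X, sat e (scons X f) a
  end.

Lemma teval_tsubst e sigma t :
  teval e (tsubst sigma t) = teval (fun n => teval e (sigma n)) t.
Proof. induction t; simpl; congruence. Qed.

Lemma teval_up1 e sigma x :
  (fun n => teval (scons x e) (up1 sigma n)) = scons x (fun n => teval e (sigma n)).
Proof.
  extensionality n; destruct n as [|n]; [reflexivity|].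
  cbn; unfold tshift; rewrite teval_tsubst; reflexivity.
Qed.

Lemma scons_up2 A (f : nat -> A) rho X :
  (fun n => scons X f (up2 rho n)) = scons X (fun n => f (rho n)).
Proof. extensionality n; destruct n; reflexivity. Qed.

Lemma sat_fsubst e f sigma rho a :
  sat e f (fsubst sigma rho a) <->
  sat (fun n => teval e (sigma n)) (fun X => f (rho X)) a.
Proof.
  revert e f sigma rho; induction a; intros; simpl;
    rewrite ?teval_tsubst; try reflexivity.
  - rewrite IHa1, IHa2; reflexivity.
  - split; intros H x; specialize (H x); revert H; rewrite IHa, teval_up1; auto.
  - split; intros H x; specialize (H x); revert H; rewrite IHa, scons_up2; auto.
Qed.

Definition models (T : form -> Prop) : Prop := forall a, T a -> forall e f, sat e f a.

End Semantics.

(** * Completeness of natural deduction *)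

Section Henkin.
Variable T : form -> Prop.
Hypothesis T_subst : forall a sigma rho, T a -> T (fsubst sigma rho a).

Definition consistent (G : list form) : Prop := ~ prf T G fbot.

(** What one step contributes to a complete theory with witnesses.  The formula
    with code [n], if consistent with the context, is added; if it negates a
    universal formula, a counterexample is added with it. *)
Definition henkin_extends (n : nat) (G G' : list form) : Prop :=
  incl G G' /\ consistent G' /\
  forall a, fcode a = n ->
    prf T G' (fneg a) \/
    In a G' /\
    (forall b, a = fneg (fall1 b) -> exists t, In (fneg (inst1 b t)) G') /\
    (forall b, a = fneg (fall2 b) -> exists X, In (fneg (inst2 b X)) G').

Lemma fbound_fresh (G : list form) :
  exists y, forall c, In c G -> fbound c <= y.
Proof.
  induction G as [|a G [y Hy]].
  - exists 0; intros c [].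
  - exists (Nat.max (fbound a) y); intros c [<-|Hc]; [lia|].
    specialize (Hy c Hc); lia.
Qed.

Lemma prf_neg_intro G a : ~ consistent (a :: G) -> prf T G (fneg a).
Proof. intros H; apply prf_imp_intro, NNPP, H. Qed.

(** Adding a refuted instance [v] of a refuted universal formula [u] is harmless
    when the instance is generic, that is, when a proof of [v] yields [u]. *)
Lemma consistent_witness G u v :
  (prf T G v -> prf T G u) -> prf T G (fneg u) -> consistent G ->
  consistent (fneg v :: G).
Proof.
  intros Huv Hu HG H; apply HG.
  eapply prf_neg_elim; [exact Hu|]; apply Huv, prf_contradiction, H.
Qed.

Lemma henkin_step n G : consistent G -> exists G', henkin_extends n G G'.
Proof.
  intros HG.
  destruct (classic (exists a, fcode a = n)) as [[a Ha]|Hn].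
  2: { exists G; split; [apply incl_refl|split; [exact HG|]].
       intros a Ha; destruct Hn; exists a; exact Ha. }
  assert (Hall : forall b, fcode b = n -> b = a)
    by (intros b Hb; apply fcode_inj; congruence).
  destruct (classic (consistent (a :: G))) as [Hc|Hc].
  2: { exists G; split; [apply incl_refl|split; [exact HG|]].
       intros b Hb; rewrite (Hall b Hb); left; apply prf_neg_intro, Hc. }
  destruct (fbound_fresh (a :: G)) as [y Hy].
  destruct (classic (exists b, a = fneg (fall1 b))) as [[b Eb]|N1];
    [|destruct (classic (exists b, a = fneg (fall2 b))) as [[b Eb]|N2]].
  - exists (fneg (inst1 b (tvar y)) :: a :: G).
    assert (Hb : fbound b <= y).
    { specialize (Hy a (or_introl eq_refl)); rewrite Eb in Hy; simpl in Hy; lia. }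
    split; [apply incl_tl, incl_tl, incl_refl|split].
    + apply consistent_witness with (u := fall1 b); [|subst; apply prf_head|auto].
      apply prf_all1_fresh; [exact T_subst|]; intros c [<-|Hin]; auto.
    + intros c Hcn; rewrite (Hall c Hcn); right.
      split; [right; left; reflexivity|split].
      * intros b' Eb'; rewrite Eb in Eb'; injection Eb' as <-.
        exists (tvar y); left; reflexivity.
      * intros b' Eb'; rewrite Eb in Eb'; discriminate.
  - exists (fneg (inst2 b y) :: a :: G).
    assert (Hb : fbound b <= y).
    { specialize (Hy a (or_introl eq_refl)); rewrite Eb in Hy; simpl in Hy; lia. }
    split; [apply incl_tl, incl_tl, incl_refl|split].
    + apply consistent_witness with (u := fall2 b); [|subst; apply prf_head|auto].
      apply prf_all2_fresh; [exact T_subst|]; intros c [<-|Hin]; auto.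
    + intros c Hcn; rewrite (Hall c Hcn); right.
      split; [right; left; reflexivity|split].
      * intros b' Eb'; rewrite Eb in Eb'; discriminate.
      * intros b' Eb'; rewrite Eb in Eb'; injection Eb' as <-.
        exists y; left; reflexivity.
  - exists (a :: G); split; [apply incl_tl, incl_refl|split; [exact Hc|]].
    intros c Hcn; rewrite (Hall c Hcn); right.
    split; [left; reflexivity|split]; intros b Eb; exfalso; eauto.
Qed.

Variable G0 : list form.
Hypothesis G0_consistent : consistent G0.

Fixpoint stage (n : nat) : {G | consistent G} :=
  match n with
  | 0 => exist _ G0 G0_consistent
  | S n =>
      let (G, HG) := stage n in
      let (G', HG') := constructive_indefinite_description _ (henkin_step n G HG) in
      exist _ G' (proj1 (proj2 HG'))
  end.

Lemma stage_step n : henkin_extends n (proj1_sig (stage n)) (proj1_sig (stage (S n))).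
Proof.
  cbn [stage]; destruct (stage n) as [G HG].
  destruct (constructive_indefinite_description _ _) as [G' HG']; exact HG'.
Qed.

Lemma stage_mono m n : m <= n -> incl (proj1_sig (stage m)) (proj1_sig (stage n)).
Proof.
  induction 1 as [|n _ IH]; [apply incl_refl|].
  eapply incl_tran; [exact IH|]; apply stage_step.
Qed.

(** As only its deductive closure matters, the limit of the contexts is taken
    directly as the set of their consequences. *)
Definition Th (a : form) : Prop := exists n, prf T (proj1_sig (stage n)) a.

Lemma stage_prf m n a :
  m <= n -> prf T (proj1_sig (stage m)) a -> prf T (proj1_sig (stage n)) a.
Proof. intros Hmn H; eapply prf_weaken; [exact H|]; apply stage_mono, Hmn. Qed.

Lemma Th_map a b : (forall G, prf T G a -> prf T G b) -> Th a -> Th b.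
Proof. intros H [n Hn]; exists n; auto. Qed.

Lemma Th_map2 a b c :
  (forall G, prf T G a -> prf T G b -> prf T G c) -> Th a -> Th b -> Th c.
Proof.
  intros H [m Hm] [n Hn]; exists (Nat.max m n).
  apply H; eapply stage_prf; try eassumption; lia.
Qed.

Lemma Th_of_prf a : (forall G, prf T G a) -> Th a.
Proof. intros H; exists 0; apply H. Qed.

Lemma Th_initial a : In a G0 -> Th a.
Proof. intros H; exists 0; apply prf_hyp, H. Qed.

Lemma Th_consistent : ~ Th fbot.
Proof. intros [n Hn]; revert Hn; apply (proj2_sig (stage n)). Qed.

Lemma Th_neg a : Th (fneg a) -> ~ Th a.
Proof.
  intros H1 H2; apply Th_consistent.
  revert H1 H2; apply Th_map2; intros G; apply prf_neg_elim.
Qed.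

Lemma Th_henkin a :
  Th (fneg a) \/
  Th a /\
  (forall b, a = fneg (fall1 b) -> exists t, Th (fneg (inst1 b t))) /\
  (forall b, a = fneg (fall2 b) -> exists X, Th (fneg (inst2 b X))).
Proof.
  assert (Hst : forall b, In b (proj1_sig (stage (S (fcode a)))) -> Th b)
    by (intros b Hb; exists (S (fcode a)); apply prf_hyp, Hb).
  destruct (stage_step (fcode a)) as (_ & _ & H).
  destruct (H a eq_refl) as [Hn|(Ha & H1 & H2)];
    [left; exists (S (fcode a)); exact Hn|right].
  split; [auto|split]; intros b Hb;
    [destruct (H1 b Hb) as [t Ht]; exists t | destruct (H2 b Hb) as [X HX]; exists X];
    auto.
Qed.

Lemma Th_complete a : Th (fneg a) \/ Th a.
Proof. destruct (Th_henkin a) as [H|[H _]]; auto. Qed.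

Lemma Th_imp a b : Th (fimp a b) <-> (Th a -> Th b).
Proof.
  split; [apply Th_map2; intros G; apply prf_imp_elim|intros H].
  destruct (Th_complete a) as [Ha|Ha].
  - revert Ha; apply Th_map; intros G HG; apply prf_imp_intro.
    apply prf_explosion, prf_neg_elim with a;
      [apply prf_mono_cons, HG|apply prf_head].
  - generalize (H Ha); apply Th_map; intros G HG.
    apply prf_imp_intro, prf_mono_cons, HG.
Qed.

Lemma Th_all1 b : Th (fall1 b) <-> forall t, Th (inst1 b t).
Proof.
  split; [intros H t; revert H; apply Th_map; intros G; apply prf_all1_elim|].
  intros H; destruct (Th_complete (fall1 b)) as [Hn|]; [exfalso|assumption].
  destruct (Th_henkin (fneg (fall1 b))) as [Hd|(_ & Hex & _)];
    [exact (Th_neg _ Hd Hn)|].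
  destruct (Hex b eq_refl) as [t Hw]; exact (Th_neg _ Hw (H t)).
Qed.

Lemma Th_all2 b : Th (fall2 b) <-> forall X, Th (inst2 b X).
Proof.
  split; [intros H X; revert H; apply Th_map; intros G; apply prf_all2_elim|].
  intros H; destruct (Th_complete (fall2 b)) as [Hn|]; [exfalso|assumption].
  destruct (Th_henkin (fneg (fall2 b))) as [Hd|(_ & _ & Hex)];
    [exact (Th_neg _ Hd Hn)|].
  destruct (Hex b eq_refl) as [X Hw]; exact (Th_neg _ Hw (H X)).
Qed.

Lemma Th_refl t : Th (feq t t).
Proof. apply Th_of_prf; intros; apply prf_eq_refl. Qed.

Lemma Th_eq_subst a s t : Th (feq s t) -> Th (inst1 a s) -> Th (inst1 a t).
Proof. apply Th_map2; intros G; apply prf_eq_subst. Qed.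

Lemma Th_sym s t : Th (feq s t) -> Th (feq t s).
Proof. apply Th_map; intros G; apply prf_eq_sym. Qed.

(** The numbers of the term structure are terms modulo provable equality.  Since
    provably equal terms have extensionally equal classes, choosing from the
    class picks the same representative for both, which makes the quotient a
    subtype of the terms. *)
Definition rep (t : term) : term :=
  epsilon (inhabits tzero) (fun s => Th (feq t s)).

Lemma Th_rep t : Th (feq t (rep t)).
Proof.
  exact (epsilon_spec (inhabits tzero) (fun s => Th (feq t s))
           (ex_intro _ t (Th_refl t))).
Qed.

Lemma Th_trans s t u : Th (feq s t) -> Th (feq t u) -> Th (feq s u).
Proof.
  intros H1 H2.
  pose proof (Th_eq_subst (feq (tshift s) (tvar 0)) t u H2) as H.
  unfold inst1 in H; cbn in H; rewrite !tsubst_scons_tshift in H; auto.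
Qed.

Lemma rep_eq s t : Th (feq s t) <-> rep s = rep t.
Proof.
  split; intros H.
  - unfold rep; f_equal; extensionality u; apply propositional_extensionality.
    split; apply Th_trans; [apply Th_sym|]; exact H.
  - apply Th_trans with (rep s); [apply Th_rep|].
    rewrite H; apply Th_sym, Th_rep.
Qed.

Definition hdom : Type := {t | rep t = t}.

Definition cls (t : term) : hdom :=
  exist _ (rep t) (eq_sym (proj1 (rep_eq t (rep t)) (Th_rep t))).

Lemma cls_eq s t : cls s = cls t <-> Th (feq s t).
Proof.
  rewrite rep_eq; split; intros H.
  - exact (f_equal (@proj1_sig _ _) H).
  - apply subset_eq_compat, H.
Qed.

Lemma cls_proj (d : hdom) : cls (proj1_sig d) = d.
Proof. destruct d as [t Ht]; apply subset_eq_compat, Ht. Qed.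

Lemma Th_eq_subst_sym a s t : Th (feq s t) -> Th (inst1 a s) <-> Th (inst1 a t).
Proof. split; apply Th_eq_subst; [|apply Th_sym]; assumption. Qed.

Lemma Th_eq_cong (c : term -> term -> form) s s' t t' :
  (exists a, forall u, c u t = inst1 a u) ->
  (exists a, forall u, c s' u = inst1 a u) ->
  Th (feq s s') -> Th (feq t t') -> Th (c s t) <-> Th (c s' t').
Proof.
  intros [a Ha] [b Hb] Hs Ht; rewrite Ha, (Th_eq_subst_sym a _ _ Hs), <- Ha.
  rewrite Hb, (Th_eq_subst_sym b _ _ Ht), <- Hb; reflexivity.
Qed.

Lemma Th_proj_cls t : Th (feq (proj1_sig (cls t)) t).
Proof. apply Th_sym, Th_rep. Qed.

Definition term_structure : structure := {|
  dom := hdom;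
  sets := nat;
  szero := cls tzero;
  sone := cls tone;
  sadd d d' := cls (tadd (proj1_sig d) (proj1_sig d'));
  smul d d' := cls (tmul (proj1_sig d) (proj1_sig d'));
  slt d d' := Th (flt (proj1_sig d) (proj1_sig d'));
  smem d X := Th (fmem (proj1_sig d) X) |}.

Lemma teval_cls sigma t :
  teval term_structure (fun n => cls (sigma n)) t = cls (tsubst sigma t).
Proof.
  induction t as [n| | |s IHs t IHt|s IHs t IHt]; simpl; try reflexivity;
    rewrite IHs, IHt; apply cls_eq.
  - set (u := tsubst sigma s); set (v := tsubst sigma t).
    apply (Th_eq_cong (fun x y => feq (tadd x y) (tadd u v)) _ u _ v);
      try apply Th_proj_cls; [| |apply Th_refl].
    + exists (feq (tadd (tvar 0) (tshift (proj1_sig (cls v)))) (tshift (tadd u v))).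
      intros w; unfold inst1; cbn -[cls]; rewrite !tsubst_scons_tshift; reflexivity.
    + exists (feq (tadd (tshift u) (tvar 0)) (tshift (tadd u v))).
      intros w; unfold inst1; cbn -[cls]; rewrite !tsubst_scons_tshift; reflexivity.
  - set (u := tsubst sigma s); set (v := tsubst sigma t).
    apply (Th_eq_cong (fun x y => feq (tmul x y) (tmul u v)) _ u _ v);
      try apply Th_proj_cls; [| |apply Th_refl].
    + exists (feq (tmul (tvar 0) (tshift (proj1_sig (cls v)))) (tshift (tmul u v))).
      intros w; unfold inst1; cbn -[cls]; rewrite !tsubst_scons_tshift; reflexivity.
    + exists (feq (tmul (tshift u) (tvar 0)) (tshift (tmul u v))).
      intros w; unfold inst1; cbn -[cls]; rewrite !tsubst_scons_tshift; reflexivity.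
Qed.

Lemma scons_cls t sigma :
  scons (cls t) (fun n => cls (sigma n)) = (fun n => cls (scons t sigma n)).
Proof. extensionality n; destruct n; reflexivity. Qed.

(** Structural induction on [a] works because the substitution is general: an
    instance of [a] by a term is [a] under another substitution.  The quantifier
    cases use the witnesses of the Henkin theory. *)
Lemma sat_Th a : forall sigma rho,
  sat term_structure (fun n => cls (sigma n)) rho a <-> Th (fsubst sigma rho a).
Proof.
  induction a as [|s t|s t|t X|a IHa b IHb|a IHa|a IHa]; intros sigma rho; simpl.
  - split; [contradiction|exact Th_consistent].
  - rewrite !teval_cls; apply cls_eq.
  - rewrite !teval_cls; apply (Th_eq_cong flt); try apply Th_proj_cls.
    + eexists (flt (tvar 0) (tshift _)).
      intros w; unfold inst1; cbn -[cls]; rewrite !tsubst_scons_tshift; reflexivity.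
    + eexists (flt (tshift _) (tvar 0)).
      intros w; unfold inst1; cbn -[cls]; rewrite !tsubst_scons_tshift; reflexivity.
  - rewrite teval_cls.
    exact (Th_eq_subst_sym (fmem (tvar 0) (rho X)) _ _ (Th_proj_cls _)).
  - rewrite IHa, IHb, Th_imp; reflexivity.
  - rewrite Th_all1; split; intros H x.
    + specialize (H (cls x)); rewrite scons_cls, IHa in H.
      rewrite inst1_up1; exact H.
    + rewrite <- (cls_proj x), scons_cls, IHa, <- inst1_up1; apply H.
  - rewrite Th_all2; split; intros H X; specialize (H X); revert H;
      rewrite inst2_up2, IHa; auto.
Qed.

Lemma term_structure_models : models term_structure T.
Proof.
  intros a Ha e f.
  replace e with (fun n => cls (proj1_sig (e n)))
    by (extensionality n; apply cls_proj).
  apply sat_Th, Th_of_prf; intros G; apply prf_ax, T_subst, Ha.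
Qed.

End Henkin.

(** If [a] is not derivable, the negation of [a] is consistent, and the term
    structure of a Henkin theory containing it satisfies [T] but not [a].
    Closure of [T] under substitution makes the axioms hold in the term structure
    under every assignment, and lets fresh variables serve as witnesses. *)
Theorem completeness (T : form -> Prop) (a : form) :
  (forall b sigma rho, T b -> T (fsubst sigma rho b)) ->
  (forall M, models M T -> forall e f, sat M e f a) ->
  proves T a.
Proof.
  intros T_subst H; apply NNPP; intros Hn.
  assert (HG : consistent T [fneg a])
    by (intros Hf; apply Hn, prf_contradiction, Hf).
  apply (Th_neg T T_subst [fneg a] HG a); [apply Th_initial; left; reflexivity|].
  rewrite <- (fsubst_id a) at 2; apply sat_Th, H, term_structure_models.
Qed.

(** * Substitution in the axioms of second-order arithmetic *)

Lemma tsubst_up1_tshift sigma t :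
  tsubst (up1 sigma) (tshift t) = tshift (tsubst sigma t).
Proof. unfold tshift; rewrite !tsubst_tsubst; reflexivity. Qed.

Lemma bounded_fsubst a : bounded a -> forall sigma rho, bounded (fsubst sigma rho a).
Proof.
  induction 1; intros sigma rho; simpl; rewrite ?tsubst_up1_tshift;
    (constructor; auto; fail).
Qed.

Lemma Sigma1_fsubst a sigma rho : Sigma1 a -> Sigma1 (fsubst sigma rho a).
Proof. intros [b Hb]; constructor; apply bounded_fsubst, Hb. Qed.

Lemma Pi1_fsubst a sigma rho : Pi1 a -> Pi1 (fsubst sigma rho a).
Proof. intros [b Hb]; constructor; apply bounded_fsubst, Hb. Qed.

Lemma fsubst_induction sigma rho a :
  fsubst sigma rho (induction a) = induction (fsubst (up1 sigma) rho a).
Proof.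
  unfold induction; cbn [fsubst fand fneg]; rewrite fsubst_inst1; simpl tsubst.
  unfold fand, fneg; do 6 f_equal.
  rewrite !fsubst_fsubst; f_equal.
  extensionality n; destruct n as [|n]; [reflexivity|].
  cbn; unfold tshift; rewrite tsubst_tsubst; reflexivity.
Qed.

Lemma fsubst_comprehension sigma rho a b :
  fsubst sigma rho (comprehension a b) =
  comprehension (fsubst (up1 sigma) rho a) (fsubst (up1 sigma) rho b).
Proof.
  unfold comprehension, fex2, fiff, fand, fneg; cbn [fsubst].
  rewrite <- !fsubst_shift2; reflexivity.
Qed.

Lemma RCA0_fsubst a sigma rho : RCA0 a -> RCA0 (fsubst sigma rho a).
Proof.
  intros [b Hb|b Hb|b c Hb Hc].
  - replace (fsubst sigma rho b) with b by (destruct Hb; reflexivity).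
    constructor; exact Hb.
  - rewrite fsubst_induction; constructor; apply Sigma1_fsubst, Hb.
  - rewrite fsubst_comprehension; constructor;
      [apply Sigma1_fsubst, Hb|apply Pi1_fsubst, Hc].
Qed.

(** * Reading off the meaning of a formula *)

(** Conjunction, disjunction and the existential quantifiers are abbreviations
    through negation, so a formula evaluates to a doubly negated statement.  One
    lemma for each connective turns this into the usual reading. *)
Section Reading.
Variable M : structure.
Implicit Types (e : nat -> dom M) (f : nat -> sets M).

Lemma sat_neg e f a P : (sat M e f a <-> P) -> sat M e f (fneg a) <-> ~ P.
Proof. intros H; simpl; rewrite H; reflexivity. Qed.

Lemma sat_imp e f a b P Q :
  (sat M e f a <-> P) -> (sat M e f b <-> Q) ->
  sat M e f (fimp a b) <-> (P -> Q).
Proof. intros H1 H2; simpl; rewrite H1, H2; reflexivity. Qed.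

Lemma sat_and e f a b P Q :
  (sat M e f a <-> P) -> (sat M e f b <-> Q) ->
  sat M e f (fand a b) <-> P /\ Q.
Proof. intros H1 H2; simpl; rewrite H1, H2; tauto. Qed.

Lemma sat_or e f a b P Q :
  (sat M e f a <-> P) -> (sat M e f b <-> Q) ->
  sat M e f (for_ a b) <-> P \/ Q.
Proof. intros H1 H2; simpl; rewrite H1, H2; tauto. Qed.

Lemma sat_iff e f a b P Q :
  (sat M e f a <-> P) -> (sat M e f b <-> Q) ->
  sat M e f (fiff a b) <-> (P <-> Q).
Proof. intros H1 H2; simpl; rewrite H1, H2; tauto. Qed.

Lemma sat_all1 e f a (P : dom M -> Prop) :
  (forall x, sat M (scons x e) f a <-> P x) ->
  sat M e f (fall1 a) <-> forall x, P x.
Proof. intros H; split; intros H' x; apply H, H'. Qed.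

Lemma sat_ex1 e f a (P : dom M -> Prop) :
  (forall x, sat M (scons x e) f a <-> P x) ->
  sat M e f (fex1 a) <-> exists x, P x.
Proof.
  intros H; unfold fex1; rewrite (sat_neg e f _ (forall x, ~ P x)).
  - split; [intros Hn; apply not_all_not_ex, Hn|firstorder].
  - apply sat_all1; intros x; apply sat_neg, H.
Qed.

Lemma sat_all2 e f a (P : sets M -> Prop) :
  (forall X, sat M e (scons X f) a <-> P X) ->
  sat M e f (fall2 a) <-> forall X, P X.
Proof. intros H; split; intros H' x; apply H, H'. Qed.

Lemma sat_ex2 e f a (P : sets M -> Prop) :
  (forall X, sat M e (scons X f) a <-> P X) ->
  sat M e f (fex2 a) <-> exists X, P X.
Proof.
  intros H; unfold fex2; rewrite (sat_neg e f _ (forall X, ~ P X)).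
  - split; [intros Hn; apply not_all_not_ex, Hn|firstorder].
  - apply sat_all2; intros x; apply sat_neg, H.
Qed.

End Reading.

(** The connectives of [form] stay folded, as [read_form] recognises them by
    their head symbol. *)
Ltac unfold_fm :=
  cbv [sentence Zero One Add Mul Eq Lt Mem Not Imp And Or Iff bound sbound
       All Ex AllS ExS pair fin_rep in_fin fin_code Pfin func nats elements
       nat_pairs quasi_order wqo csc_space in_open in_closed noetherian
       alexandroff down upper A_noetherian U_noetherian
       Nat.sub].

Ltac read_form :=
  match goal with
  | |- sat _ _ _ (fneg _) <-> _ => apply sat_neg
  | |- sat _ _ _ (fand _ _) <-> _ => apply sat_and
  | |- sat _ _ _ (for_ _ _) <-> _ => apply sat_or
  | |- sat _ _ _ (fiff _ _) <-> _ => apply sat_iff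
  | |- sat _ _ _ (fimp _ _) <-> _ => apply sat_imp
  | |- sat _ _ _ (fex1 _) <-> _ => apply sat_ex1; intros ?
  | |- sat _ _ _ (fex2 _) <-> _ => apply sat_ex2; intros ?
  | |- sat _ _ _ (fall1 _) <-> _ => apply sat_all1; intros ?
  | |- sat _ _ _ (fall2 _) <-> _ => apply sat_all2; intros ?
  | |- sat _ _ _ _ <-> _ => cbn [sat teval scons]; apply iff_refl
  end.

(** * Definability with parameters *)

(** Arguments and parameters of a predicate share one assignment, arguments at
    the even places.  Since both halves are infinite, the parameters of two
    formulas can be merged by renaming, with no count of the variables in use. *)
Definition mix {A} (e p : nat -> A) (n : nat) : A :=
  if Nat.even n then e (Nat.div2 n) else p (Nat.div2 n).

Lemma mix_even A (e p : nat -> A) n : mix e p (2 * n) = e n.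
Proof.
  unfold mix; rewrite Nat.even_even, Nat.div2_double; reflexivity.
Qed.

Lemma mix_odd A (e p : nat -> A) n : mix e p (2 * n + 1) = p n.
Proof.
  unfold mix; rewrite Nat.even_odd, Nat.add_1_r, Nat.div2_succ_double; reflexivity.
Qed.

Lemma even_odd_split n : (exists k, n = 2 * k) \/ (exists k, n = 2 * k + 1).
Proof.
  destruct (Nat.Even_or_Odd n) as [[k ->]|[k ->]]; eauto.
Qed.

Definition mix_left (m : nat) : nat := if Nat.even m then m else 2 * m - 1.
Definition mix_right (m : nat) : nat := if Nat.even m then m else 2 * m + 1.

Lemma mix_mix_left A (e p q : nat -> A) m :
  mix e (mix p q) (mix_left m) = mix e p m.
Proof.
  unfold mix_left; destruct (even_odd_split m) as [[k ->]|[k ->]].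
  - rewrite Nat.even_even, !mix_even; reflexivity.
  - rewrite Nat.even_odd.
    replace (2 * (2 * k + 1) - 1) with (2 * (2 * k) + 1) by lia.
    rewrite !mix_odd, mix_even; reflexivity.
Qed.

Lemma mix_mix_right A (e p q : nat -> A) m :
  mix e (mix p q) (mix_right m) = mix e q m.
Proof.
  unfold mix_right; destruct (even_odd_split m) as [[k ->]|[k ->]].
  - rewrite Nat.even_even, !mix_even; reflexivity.
  - rewrite Nat.even_odd, !mix_odd; reflexivity.
Qed.

(** A quantifier puts its variable in front of the whole assignment, whereas it
    belongs to the arguments. *)
Definition mix_push (m : nat) : nat :=
  if Nat.even m then Nat.pred m else S m.

Lemma scons_mix A (x : A) e p m : scons x (mix e p) (mix_push m) = mix (scons x e) p m.
Proof.
  unfold mix_push; destruct (even_odd_split m) as [[[|k] ->]|[k ->]].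
  - reflexivity.
  - rewrite Nat.even_even, mix_even.
    replace (Nat.pred (2 * S k)) with (S (2 * k)) by lia; simpl scons.
    apply mix_even.
  - rewrite Nat.even_odd, mix_odd; apply mix_odd.
Qed.

(** The set witnesses that the second sort is inhabited, which an assignment for
    set variables requires. *)
Class RCA0_model (M : structure) : Type := {
  model_set : sets M;
  model_RCA0 : models M RCA0 }.

Section Definability.
Context {M : structure}.
Notation D := (dom M).

(** The function is semantic and the term only exists: closure lemmas can then be
    applied to functions written directly over the domain, with any of its
    elements as constants. *)
Definition Tm (t : (nat -> D) -> D) : Prop :=
  exists u p, forall e, t e = teval M (mix e p) u.

(** The bounded formulas with number and set parameters, seen as the predicates
    that they define. *)
Definition B0 (P : (nat -> D) -> Prop) : Prop :=
  exists a p f, bounded a /\ forall e, P e <-> sat M (mix e p) f a.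

Lemma teval_rename e sigma t :
  teval M e (tsubst (fun n => tvar (sigma n)) t) = teval M (fun n => e (sigma n)) t.
Proof. rewrite teval_tsubst; reflexivity. Qed.

Lemma sat_rename e f sigma rho a :
  sat M e f (fsubst (fun n => tvar (sigma n)) rho a) <->
  sat M (fun n => e (sigma n)) (fun X => f (rho X)) a.
Proof. apply sat_fsubst. Qed.

Lemma Tm_merge t t' : Tm t -> Tm t' ->
  exists u u' p, forall e, t e = teval M (mix e p) u /\ t' e = teval M (mix e p) u'.
Proof.
  intros (u & p & Hu) (u' & p' & Hu').
  exists (tsubst (fun n => tvar (mix_left n)) u),
    (tsubst (fun n => tvar (mix_right n)) u'), (mix p p').
  intros e; rewrite !teval_rename, Hu, Hu'.
  split; f_equal; extensionality n; symmetry;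
    [apply mix_mix_left|apply mix_mix_right].
Qed.

Lemma B0_merge P P' : B0 P -> B0 P' ->
  exists a a' p f, bounded a /\ bounded a' /\
    forall e, (P e <-> sat M (mix e p) f a) /\ (P' e <-> sat M (mix e p) f a').
Proof.
  intros (a & p & f & Ba & Ha) (a' & p' & f' & Ba' & Ha').
  exists (fsubst (fun n => tvar (mix_left n)) (fun n => 2 * n) a),
    (fsubst (fun n => tvar (mix_right n)) (fun n => 2 * n + 1) a'),
    (mix p p'), (mix f f').
  split; [apply bounded_fsubst, Ba|split; [apply bounded_fsubst, Ba'|]].
  intros e; rewrite !sat_rename, Ha, Ha'; split.
  - replace (fun n => mix e (mix p p') (mix_left n)) with (mix e p)
      by (extensionality n; symmetry; apply mix_mix_left).
    replace (fun n => mix f f' (2 * n)) with f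
      by (extensionality n; symmetry; apply mix_even); reflexivity.
  - replace (fun n => mix e (mix p p') (mix_right n)) with (mix e p')
      by (extensionality n; symmetry; apply mix_mix_right).
    replace (fun n => mix f f' (2 * n + 1)) with f'
      by (extensionality n; symmetry; apply mix_odd); reflexivity.
Qed.

Lemma Tm_var n : Tm (fun e => e n).
Proof.
  exists (tvar (2 * n)), (fun _ => szero M); intros e; symmetry; apply mix_even.
Qed.

Lemma Tm_const c : Tm (fun _ => c).
Proof. exists (tvar 1), (fun _ => c); reflexivity. Qed.

Lemma Tm_add t t' : Tm t -> Tm t' -> Tm (fun e => sadd M (t e) (t' e)).
Proof.
  intros H H'; destruct (Tm_merge _ _ H H') as (u & u' & p & E).
  exists (tadd u u'), p; intros e; destruct (E e) as [-> ->]; reflexivity.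
Qed.

Lemma Tm_mul t t' : Tm t -> Tm t' -> Tm (fun e => smul M (t e) (t' e)).
Proof.
  intros H H'; destruct (Tm_merge _ _ H H') as (u & u' & p & E).
  exists (tmul u u'), p; intros e; destruct (E e) as [-> ->]; reflexivity.
Qed.

Lemma Tm_rename t s : Tm t -> Tm (fun e => t (fun n => e (s n))).
Proof.
  intros (u & p & Hu).
  exists (tsubst (fun m => tvar (if Nat.even m then 2 * s (Nat.div2 m) else m)) u), p.
  intros e; rewrite teval_rename, Hu; f_equal; extensionality m.
  destruct (even_odd_split m) as [[k ->]|[k ->]].
  - rewrite Nat.even_even, Nat.div2_double, !mix_even; reflexivity.
  - rewrite Nat.even_odd, !mix_odd; reflexivity.
Qed.

Context {RM : RCA0_model M}.

Lemma B0_ext P Q : B0 P -> (forall e, Q e <-> P e) -> B0 Q.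
Proof.
  intros (a & p & f & Ba & Ha) H; exists a, p, f; split; [exact Ba|].
  intros e; rewrite H; apply Ha.
Qed.

Lemma B0_eq t t' : Tm t -> Tm t' -> B0 (fun e => t e = t' e).
Proof.
  intros H H'; destruct (Tm_merge _ _ H H') as (u & u' & p & E).
  exists (feq u u'), p, (fun _ => model_set); split; [constructor|].
  intros e; destruct (E e) as [-> ->]; reflexivity.
Qed.

Lemma B0_lt t t' : Tm t -> Tm t' -> B0 (fun e => slt M (t e) (t' e)).
Proof.
  intros H H'; destruct (Tm_merge _ _ H H') as (u & u' & p & E).
  exists (flt u u'), p, (fun _ => model_set); split; [constructor|].
  intros e; destruct (E e) as [-> ->]; reflexivity.
Qed.

Lemma B0_mem t X : Tm t -> B0 (fun e => smem M (t e) X).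
Proof.
  intros (u & p & E); exists (fmem u 0), p, (fun _ => X); split; [constructor|].
  intros e; rewrite E; reflexivity.
Qed.

Lemma B0_False : B0 (fun _ => False).
Proof.
  exists fbot, (fun _ => szero M), (fun _ => model_set); split; [constructor|].
  intros e; reflexivity.
Qed.

Lemma B0_imp P Q : B0 P -> B0 Q -> B0 (fun e => P e -> Q e).
Proof.
  intros H H'; destruct (B0_merge _ _ H H') as (a & b & p & f & Ba & Bb & E).
  exists (fimp a b), p, f; split; [constructor; assumption|].
  intros e; destruct (E e) as [-> ->]; reflexivity.
Qed.

Lemma B0_not P : B0 P -> B0 (fun e => ~ P e).
Proof. intros H; exact (B0_imp _ _ H B0_False). Qed.

Lemma B0_or P Q : B0 P -> B0 Q -> B0 (fun e => P e \/ Q e).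
Proof.
  intros H H'; apply (B0_ext _ _ (B0_imp _ _ (B0_not _ H) H')); intros e; tauto.
Qed.

Lemma B0_and P Q : B0 P -> B0 Q -> B0 (fun e => P e /\ Q e).
Proof.
  intros H H'.
  apply (B0_ext _ _ (B0_not _ (B0_imp _ _ H (B0_not _ H')))); intros e; tauto.
Qed.

Lemma B0_iff P Q : B0 P -> B0 Q -> B0 (fun e => P e <-> Q e).
Proof. intros H H'; apply B0_and; apply B0_imp; assumption. Qed.

(** In [R e x] the environment [e] is that outside the quantifier; inside, the
    quantified variable is entry [0] and the others are shifted.  With [R]
    abstracted in this way, higher-order unification finds it from the goal. *)
Lemma B0_all t R : Tm t -> B0 (fun e => R (fun n => e (S n)) (e 0)) ->
  B0 (fun e => forall x, slt M x (t e) -> R e x).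
Proof.
  intros (u & q & Hu) (a & p & f & Ba & Ha).
  exists (fall1 (fimp
    (flt (tvar 0) (tshift (tsubst (fun n => tvar (mix_left n)) u)))
    (fsubst (fun n => tvar (mix_push (mix_right n))) (fun X => X) a))), (mix q p), f.
  split; [constructor; apply bounded_fsubst, Ba|intros e].
  simpl; unfold tshift.
  assert (E : forall x, R e x <->
    sat M (scons x (mix e (mix q p))) f
      (fsubst (fun n => tvar (mix_push (mix_right n))) (fun X => X) a)).
  { intros x; rewrite sat_rename.
    replace (fun n => scons x (mix e (mix q p)) (mix_push (mix_right n)))
      with (mix (scons x e) p); [exact (Ha (scons x e))|].
    extensionality n; rewrite scons_mix, mix_mix_right; reflexivity. }
  assert (E' : forall x, teval M (scons x (mix e (mix q p)))
     (tsubst (fun n => tvar (S n)) (tsubst (fun n => tvar (mix_left n)) u)) = t e).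
  { intros x; rewrite !teval_rename, Hu; f_equal.
    extensionality n; apply mix_mix_left. }
  split; intros H x; specialize (H x); revert H; rewrite E', E; auto.
Qed.

Lemma B0_ex t R : Tm t -> B0 (fun e => R (fun n => e (S n)) (e 0)) ->
  B0 (fun e => exists x, slt M x (t e) /\ R e x).
Proof.
  intros Ht HR.
  pose proof (B0_not _ (B0_all t (fun e x => ~ R e x) Ht (B0_not _ HR))) as H.
  apply (B0_ext _ _ H); intros e; split.
  - intros (x & Hx & HRx) Hn; exact (Hn x Hx HRx).
  - intros Hn; apply NNPP; intros Hex; apply Hn; intros x Hx HRx.
    apply Hex; exists x; auto.
Qed.

(** The innermost quantifier of a [Sigma1] formula binds the witness, so the
    witness [y] comes before the argument [x] in the assignment.  Comprehension
    takes two formulas under the same assignment, hence the simultaneous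
    statement. *)
Lemma B0_formulas R R' :
  B0 (fun e => R (e 0) (e 1)) -> B0 (fun e => R' (e 0) (e 1)) ->
  exists a a' p f, bounded a /\ bounded a' /\
    forall x y, (R x y <-> sat M (scons y (scons x p)) f a) /\
                (R' x y <-> sat M (scons y (scons x p)) f a').
Proof.
  intros H H'; destruct (B0_merge _ _ H H') as (a & a' & p & f & Ba & Ba' & E).
  set (sigma := fun m => if Nat.even m then
         match m with 0 => 1 | _ => 0 end else S (S (Nat.div2 m))).
  exists (fsubst (fun n => tvar (sigma n)) (fun X => X) a),
    (fsubst (fun n => tvar (sigma n)) (fun X => X) a'), p, f.
  split; [apply bounded_fsubst, Ba|split; [apply bounded_fsubst, Ba'|]].
  intros x y; rewrite !sat_rename.
  replace (fun n => scons y (scons x p) (sigma n)) with (mix (scons x (fun _ => y)) p).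
  - exact (E (scons x (fun _ => y))).
  - extensionality m; unfold mix, sigma; destruct (Nat.even m) eqn:Em; [|reflexivity].
    destruct m as [|[|m]]; [reflexivity|discriminate|reflexivity].
Qed.

Lemma sigma1_induction R :
  B0 (fun e => R (e 0) (e 1)) ->
  (exists y, R (szero M) y) ->
  (forall x, (exists y, R x y) -> exists y, R (sadd M x (sone M)) y) ->
  forall x, exists y, R x y.
Proof.
  intros HR H0 HS.
  destruct (B0_formulas R R HR HR) as (a & a' & p & f & Ba & _ & E).
  assert (Ex : forall x, (exists y, R x y) <-> sat M (scons x p) f (fex1 a)).
  { intros x; symmetry; apply sat_ex1; intros y; symmetry; apply E. }
  intros x; apply Ex; revert x.
  refine (model_RCA0 _ (RCA0_induction (fex1 a) (Sigma1_intro a Ba)) p f _).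
  apply (sat_and M p f _ _ _ _ (iff_refl _) (iff_refl _)); split.
  - unfold inst1; rewrite sat_fsubst.
    replace (fun n => teval M p (scons tzero tvar n)) with (scons (szero M) p)
      by (extensionality n; destruct n; reflexivity).
    apply Ex, H0.
  - intros x Hx; rewrite sat_fsubst.
    replace (fun n => teval M (scons x p) _) with (scons (sadd M x (sone M)) p)
      by (extensionality n; destruct n; reflexivity).
    apply Ex, HS, Ex, Hx.
Qed.

Lemma delta1_comprehension R R' :
  B0 (fun e => R (e 0) (e 1)) -> B0 (fun e => R' (e 0) (e 1)) ->
  (forall x, (exists y, R x y) <-> (forall y, R' x y)) ->
  exists X, forall x, smem M x X <-> exists y, R x y.
Proof.
  intros HR HR' H.
  destruct (B0_formulas R R' HR HR') as (a & a' & p & f & Ba & Ba' & E).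
  assert (Ex : forall x, sat M (scons x p) f (fex1 a) <-> exists y, R x y).
  { intros x; apply sat_ex1; intros y; symmetry; apply E. }
  assert (Ex' : forall x, sat M (scons x p) f (fall1 a') <-> forall y, R' x y).
  { intros x; apply sat_all1; intros y; symmetry; apply E. }
  pose proof (model_RCA0 _ (RCA0_comprehension _ _ (Sigma1_intro a Ba) (Pi1_intro a' Ba')) p f)
    as C.
  change (sat M p f (fall1 (fiff (fex1 a) (fall1 a'))) ->
    sat M p f (fex2 (fall1 (fiff (fmem (tvar 0) 0) (shift2 (fex1 a)))))) in C.
  refine (proj1 (sat_ex2 M p f _
    (fun X => forall x, smem M x X <-> exists y, R x y) _) (C _)).
  - intros X; apply sat_all1; intros x; apply sat_iff; [reflexivity|].
    rewrite <- Ex; unfold shift2; rewrite sat_fsubst; reflexivity.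
  - intros x.
    apply (proj2 (sat_iff M _ _ _ _ _ _ (Ex x) (Ex' x))), H.
Qed.

End Definability.

(** * Arithmetic *)

Declare Scope model_scope.
Delimit Scope model_scope with M.
Notation "0" := (szero _) : model_scope.
Notation "1" := (sone _) : model_scope.
Notation "x + y" := (sadd _ x y) : model_scope.
Notation "x * y" := (smul _ x y) : model_scope.
Notation "x < y" := (slt _ x y) : model_scope.
Notation "x <= y" := (slt _ x y \/ x = y) : model_scope.
Notation "x \in X" := (smem _ x X) : model_scope.

Definition pr {M : structure} (x y : dom M) : dom M :=
  ((x + y) * (x + y) + x)%M.
Notation "<< x , y >>" := (pr x y) : model_scope.
Local Open Scope model_scope.

Ltac tm :=
  cbv beta;
  lazymatch goal with
  | |- Tm (fun e => sadd _ _ _) => apply Tm_add; tm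
  | |- Tm (fun e => smul _ _ _) => apply Tm_mul; tm
  | |- Tm (fun e => pr _ _) => unfold pr; tm
  | |- Tm (fun e => e _) => apply Tm_var
  | |- Tm (fun _ => ?c) => apply (Tm_const c)
  | |- _ => first [assumption | apply Tm_rename; assumption]
  end.

Section Arithmetic.
Context {M : structure} {RM : RCA0_model M}.
Notation D := (dom M).
Implicit Types x y z : D.

Lemma semiring_reading a P : semiring_axiom a ->
  (forall e f, sat M e f a <-> P) -> P.
Proof.
  intros Ha H; apply (H (fun _ => 0) (fun _ => model_set)), model_RCA0, RCA0_semiring, Ha.
Qed.

Ltac from_axiom ax :=
  refine (semiring_reading _ _ ax _); intros; unfold_fm; repeat read_form.

Lemma addA x y z : (x + y) + z = x + (y + z).
Proof. revert x y z; from_axiom ax_addA. Qed.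
Lemma addC x y : x + y = y + x.
Proof. revert x y; from_axiom ax_addC. Qed.
Lemma mulA x y z : (x * y) * z = x * (y * z).
Proof. revert x y z; from_axiom ax_mulA. Qed.
Lemma mulC x y : x * y = y * x.
Proof. revert x y; from_axiom ax_mulC. Qed.
Lemma mulDr x y z : x * (y + z) = x * y + x * z.
Proof. revert x y z; from_axiom ax_mulDr. Qed.
Lemma add0 x : x + 0 = x.
Proof. revert x; from_axiom ax_add0. Qed.
Lemma mul0 x : x * 0 = 0.
Proof. revert x; from_axiom ax_mul0. Qed.
Lemma mul1 x : x * 1 = x.
Proof. revert x; from_axiom ax_mul1. Qed.
Lemma lt_trans x y z : x < y -> y < z -> x < z.
Proof.
  intros H1 H2; assert (H : forall x y z, x < y /\ y < z -> x < z)
    by from_axiom ax_lt_trans; eauto.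
Qed.
Lemma lt_irrefl x : ~ x < x.
Proof. revert x; from_axiom ax_lt_irrefl. Qed.
Lemma lt_total x y : x < y \/ x = y \/ y < x.
Proof. revert x y; from_axiom ax_lt_total. Qed.
Lemma lt_add x y z : x < y -> x + z < y + z.
Proof. revert x y z; from_axiom ax_lt_add. Qed.
Lemma lt_diff x y : x < y -> exists z, x + z = y.
Proof. revert x y; from_axiom ax_lt_diff. Qed.
Lemma lt01 : (0 : D) < 1.
Proof. from_axiom ax_lt01. Qed.
Lemma discrete x : 0 < x -> 1 <= x.
Proof. revert x; from_axiom ax_discrete. Qed.
Lemma le0 x : 0 <= x.
Proof. revert x; from_axiom ax_le0. Qed.

Lemma model_semiring : semi_ring_theory (0 : D) 1 (sadd M) (smul M) eq.
Proof.
  constructor; intros.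
  - rewrite addC; apply add0.
  - apply addC.
  - symmetry; apply addA.
  - rewrite mulC; apply mul1.
  - rewrite mulC; apply mul0.
  - apply mulC.
  - symmetry; apply mulA.
  - rewrite !(mulC _ p), mulDr; reflexivity.
Qed.
Add Ring model_ring : model_semiring.

Lemma lt_le_trans x y z : x < y -> y <= z -> x < z.
Proof. intros H [H'|<-]; eauto using lt_trans. Qed.
Lemma le_lt_trans x y z : x <= y -> y < z -> x < z.
Proof. intros [H| ->]; eauto using lt_trans. Qed.
Lemma le_trans x y z : x <= y -> y <= z -> x <= z.
Proof. intros [H| ->]; eauto using lt_le_trans. Qed.
Lemma lt_not_le x y : x < y -> ~ y <= x.
Proof. intros H H'; exact (lt_irrefl x (lt_le_trans _ _ _ H H')). Qed.
Lemma lt_or_le x y : x < y \/ y <= x.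
Proof. destruct (lt_total x y) as [H|[->|H]]; auto. Qed.
Lemma le_antisym x y : x <= y -> y <= x -> x = y.
Proof. intros [H|E] H'; [destruct (lt_not_le _ _ H H')|exact E]. Qed.

Lemma not_lt0 x : ~ x < 0.
Proof. intros H; exact (lt_not_le _ _ H (le0 x)). Qed.

Lemma add_cancel x y z : x + z = y + z -> x = y.
Proof.
  intros E; destruct (lt_total x y) as [H|[H|H]]; [|assumption|];
    apply (lt_add _ _ z) in H; rewrite E in H; destruct (lt_irrefl _ H).
Qed.

Lemma le_diff x y : x <= y -> exists z, x + z = y.
Proof. intros [H| ->]; [apply lt_diff, H|exists 0; apply add0]. Qed.

Lemma le_add_r x y : x <= x + y.
Proof.
  destruct (le0 y) as [H| <-]; [left|right; ring].
  apply (lt_add _ _ x) in H; rewrite (addC x y).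
  replace x with (0 + x) at 1 by ring; exact H.
Qed.
Lemma le_add_l x y : y <= x + y.
Proof. rewrite addC; apply le_add_r. Qed.

Lemma lt_succ x : x < x + 1.
Proof.
  rewrite addC; replace x with (0 + x) at 1 by ring; apply lt_add, lt01.
Qed.

Lemma lt_diff_pos x y : x < y -> exists z, x + (z + 1) = y.
Proof.
  intros H; destruct (lt_diff _ _ H) as [z Hz].
  destruct (le0 z) as [Hz0| <-].
  - destruct (le_diff _ _ (discrete z Hz0)) as [w <-].
    exists w; rewrite <- Hz; ring.
  - rewrite add0 in Hz; subst; destruct (lt_irrefl _ H).
Qed.

Lemma lt_succ_le x y : x < y + 1 <-> x <= y.
Proof.
  split; intros H; [|exact (le_lt_trans _ _ _ H (lt_succ y))].
  destruct (lt_or_le y x) as [Hyx|]; [|assumption].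
  destruct (lt_diff_pos _ _ Hyx) as [z Ez].
  destruct (lt_not_le _ _ H); rewrite <- Ez.
  replace (y + (z + 1)) with ((y + 1) + z) by ring; apply le_add_r.
Qed.

Lemma succ_le_lt x y : x + 1 <= y <-> x < y.
Proof.
  split; intros H; [exact (lt_le_trans _ _ _ (lt_succ x) H)|].
  destruct (lt_diff_pos _ _ H) as [z <-].
  replace (x + (z + 1)) with ((x + 1) + z) by ring; apply le_add_r.
Qed.

Lemma zero_or_succ x : x = 0 \/ exists y, x = y + 1.
Proof.
  destruct (le0 x) as [H| <-]; [right|auto].
  destruct (lt_diff_pos _ _ H) as [z <-]; exists z; ring.
Qed.

Lemma add_eq0 x y : x + y = 0 -> x = 0.
Proof.
  intros E; apply le_antisym; [rewrite <- E; apply le_add_r|apply le0].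
Qed.

Lemma succ_neq0 x : x + 1 <> 0.
Proof. intros E; apply (not_lt0 x); rewrite <- E; apply lt_succ. Qed.

Lemma le_mul_succ x y : x <= x * (y + 1).
Proof. replace (x * (y + 1)) with (x + x * y) by ring; apply le_add_r. Qed.

Lemma le_square x : x <= x * x.
Proof.
  destruct (zero_or_succ x) as [->|[y ->]]; [right; ring|apply le_mul_succ].
Qed.

Lemma le_pr_l x y : x <= <<x, y>>.
Proof. apply le_add_l. Qed.
Lemma le_pr_r x y : y <= <<x, y>>.
Proof.
  eapply le_trans; [apply (le_add_l x y)|].
  eapply le_trans; [apply le_square|apply le_add_r].
Qed.

Lemma pr_sum_le x y x' y' : <<x, y>> = <<x', y'>> -> x + y <= x' + y'.
Proof.
  intros E; destruct (lt_or_le (x' + y') (x + y)) as [H|]; [exfalso|assumption].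
  destruct (lt_diff_pos _ _ H) as [z Ez].
  (* With [s = x' + y'], [(s + 1) ^ 2] exceeds [s ^ 2 + x'] because [x' <= s]. *)
  apply (lt_irrefl <<x, y>>); rewrite E at 1; unfold pr; rewrite <- Ez.
  apply lt_le_trans with ((x' + y') * (x' + y') + x' + 1); [apply lt_succ|].
  match goal with |- ?u <= ?v =>
    replace v with (u + ((x' + y') + y' + z * z + (1 + 1) * z * (x' + y')
      + (1 + 1) * z + x)) by ring
  end; apply le_add_r.
Qed.

Lemma pr_inj x y x' y' : <<x, y>> = <<x', y'>> -> x = x' /\ y = y'.
Proof.
  intros E.
  assert (Es : x + y = x' + y')
    by (apply le_antisym; apply pr_sum_le; auto).
  assert (x = x').
  { unfold pr in E; rewrite Es in E.
    apply (add_cancel _ _ ((x' + y') * (x' + y'))).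
    rewrite !(addC _ ((x' + y') * (x' + y'))); exact E. }
  subst x'; split; [reflexivity|].
  apply (add_cancel _ _ x); rewrite (addC y), (addC y'); exact Es.
Qed.

(** ** Induction, least elements and comprehension for bounded predicates *)

Lemma delta0_induction (P : D -> Prop) :
  B0 (fun e => P (e 0%nat)) ->
  P 0 -> (forall x, P x -> P (x + 1)) -> forall x, P x.
Proof.
  intros HP H0 HS x.
  refine (match sigma1_induction (fun x _ => P x) HP _ _ x with
          | ex_intro _ _ H => H end).
  - exists 0; exact H0.
  - intros y [z Hz]; exists z; auto.
Qed.

Lemma delta0_least (P : D -> Prop) :
  B0 (fun e => P (e 0%nat)) -> (exists x, P x) ->
  exists x, P x /\ forall y, y < x -> ~ P y.
Proof.
  intros HP [x Px]; apply NNPP; intros Hn.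
  assert (H : forall z y, y < z -> ~ P y).
  { apply (delta0_induction (fun z => forall y, y < z -> ~ P y)).
    - apply (B0_all (fun e => e 0%nat) (fun _ y => ~ P y)); [apply Tm_var|].
      apply B0_not; assumption.
    - intros y Hy; destruct (not_lt0 _ Hy).
    - intros z IH y Hy Py; apply lt_succ_le in Hy; destruct Hy as [Hy| ->].
      + exact (IH y Hy Py).
      + apply Hn; eauto. }
  exact (H _ _ (lt_succ x) Px).
Qed.

Lemma delta0_comprehension (P : D -> Prop) :
  B0 (fun e => P (e 0%nat)) -> exists X, forall x, x \in X <-> P x.
Proof.
  intros HP.
  destruct (delta1_comprehension (fun x _ => P x) (fun x _ => P x) HP HP)
    as [X HX].
  - intros x; split; [intros [_ H] _; exact H|intros H; exists 0; exact (H 0)].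
  - exists X; intros x; rewrite HX; split; [intros [_ H]; exact H|].
    intros H; exists 0; exact H.
Qed.

Lemma B0_all_le t R : Tm t -> B0 (fun e => R (fun n => e (S n)) (e 0%nat)) ->
  B0 (fun e => forall x, x <= t e -> R e x).
Proof.
  intros Ht HR.
  apply (B0_ext (fun e => forall x, x < t e + 1 -> R e x)).
  - apply B0_all; [apply Tm_add; [exact Ht|apply Tm_const]|exact HR].
  - intros e; split; intros H x Hx; apply H, lt_succ_le, Hx.
Qed.

Lemma B0_ex_le t R : Tm t -> B0 (fun e => R (fun n => e (S n)) (e 0%nat)) ->
  B0 (fun e => exists x, x <= t e /\ R e x).
Proof.
  intros Ht HR.
  apply (B0_ext (fun e => exists x, x < t e + 1 /\ R e x)).
  - apply B0_ex; [apply Tm_add; [exact Ht|apply Tm_const]|exact HR].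
  - intros e; split; intros (x & Hx & H); exists x; split; auto; apply lt_succ_le, Hx.
Qed.

End Arithmetic.

(** Extended below by the closure lemmas for defined predicates. *)
Ltac b0_atom := fail.
Ltac b0 :=
  cbv beta;
  lazymatch goal with
  | |- B0 (fun e => @?P e <-> @?Q e) => apply (B0_iff P Q); b0
  | |- B0 (fun e => @?P e /\ @?Q e) => apply (B0_and P Q); b0
  | |- B0 (fun e => @?P e \/ @?Q e) => apply (B0_or P Q); b0
  | |- B0 (fun e => ~ @?P e) => apply (B0_not P); b0
  | |- B0 (fun e => _ = _) => apply B0_eq; tm
  | |- B0 (fun e => slt _ _ _) => apply B0_lt; tm
  | |- B0 (fun e => smem _ _ _) => apply B0_mem; tm
  | |- B0 (fun e => forall x, slt _ x (@?t e) -> @?R e x) =>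
      apply (B0_all t R); [tm|b0]
  | |- B0 (fun e => forall x, x <= (@?t e) -> @?R e x) =>
      apply (B0_all_le t R); [tm|b0]
  | |- B0 (fun e => exists x, slt _ x (@?t e) /\ @?R e x) =>
      apply (B0_ex t R); [tm|b0]
  | |- B0 (fun e => exists x, x <= (@?t e) /\ @?R e x) =>
      apply (B0_ex_le t R); [tm|b0]
  | |- B0 (fun e => @?P e -> @?Q e) => apply (B0_imp P Q); b0
  | |- _ => first [assumption | b0_atom | idtac]
  end.

(** * Codes of finite sets *)

Section FiniteSets.
Context {M : structure} {RM : RCA0_model M}.
Notation D := (dom M).
Implicit Types a b c d i j k m n x y z : D.
Add Ring model_ring : (@model_semiring M RM).

Definition FinRep c : Prop := exists k m n, c = <<k, <<m, n>>>>.

Definition InFin i c : Prop :=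
  exists k m n, c = <<k, <<m, n>>>> /\ i < k /\ exists d, n = (m * (i + 1) + 1) * d.

Definition FinCode c : Prop :=
  FinRep c /\ forall b, b < c -> FinRep b -> ~ (forall i, InFin i b <-> InFin i c).

Definition dvd a b : Prop := exists d, b = a * d.

Lemma dvd_mul_r a b c : dvd a b -> dvd a (b * c).
Proof. intros [d ->]; exists (d * c); ring. Qed.

Lemma dvd_add_cancel a b c : dvd a (b + c) -> dvd a c -> dvd a b.
Proof.
  intros [u Eu] [v Ev]; destruct (lt_or_le u v) as [H|H].
  - destruct (lt_diff _ _ H) as [w <-].
    exists 0; rewrite mul0; apply (add_eq0 _ (a * w)), (add_cancel _ _ (a * u)).
    rewrite Ev in Eu.
    replace (b + a * w + a * u) with (b + a * (u + w)) by ring; rewrite Eu; ring.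
  - destruct (le_diff _ _ H) as [w <-].
    exists w; apply (add_cancel _ _ c); rewrite Eu, Ev; ring.
Qed.

Lemma B0_dvd t t' : Tm t -> Tm t' -> B0 (fun e => dvd (t e) (t' e)).
Proof.
  intros Ht Ht'; apply (B0_ext (fun e => exists d, d <= t' e /\ t' e = t e * d)).
  - b0.
  - intros e; split; [|intros (d & _ & H); exists d; exact H].
    intros [d Ed]; destruct (zero_or_succ (t e)) as [E0|[a Ea]].
    + exists 0; split; [apply le0|]; rewrite Ed, E0; ring.
    + exists d; split; [|exact Ed].
      rewrite Ed, Ea, mulC; apply le_mul_succ.
Qed.

Lemma InFin_pr i k m n :
  InFin i <<k, <<m, n>>>> <-> i < k /\ dvd (m * (i + 1) + 1) n.
Proof.
  split.
  - intros (k' & m' & n' & E & Hi & Hd).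
    apply pr_inj in E as [<- E]; apply pr_inj in E as [<- <-]; auto.
  - intros [Hi Hd]; exists k, m, n; auto.
Qed.

Lemma le_code k m n : k <= <<k, <<m, n>>>> /\ m <= <<k, <<m, n>>>> /\ n <= <<k, <<m, n>>>>.
Proof.
  split; [apply le_pr_l|split]; (eapply le_trans; [|apply le_pr_r]).
  - apply le_pr_l.
  - apply le_pr_r.
Qed.

Lemma InFin_lt i c : InFin i c -> i < c.
Proof.
  intros (k & m & n & -> & Hi & _); exact (lt_le_trans _ _ _ Hi (proj1 (le_code _ _ _))).
Qed.

Lemma B0_InFin t t' : Tm t -> Tm t' -> B0 (fun e => InFin (t e) (t' e)).
Proof.
  intros Ht Ht'.
  apply (B0_ext (fun e => exists k, k <= t' e /\ exists m, m <= t' e /\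
    exists n, n <= t' e /\ t' e = <<k, <<m, n>>>> /\ t e < k /\
      dvd (m * (t e + 1) + 1) n)).
  - b0; apply B0_dvd; tm.
  - intros e; split; [|intros (k & _ & m & _ & n & _ & H); exists k, m, n; exact H].
    intros (k & m & n & E & H); destruct (le_code k m n) as (Hk & Hm & Hn).
    rewrite <- E in Hk, Hm, Hn; exists k; split; [exact Hk|].
    exists m; split; [exact Hm|]; exists n; auto.
Qed.

Lemma B0_FinRep t : Tm t -> B0 (fun e => FinRep (t e)).
Proof.
  intros Ht.
  apply (B0_ext (fun e => exists k, k <= t e /\ exists m, m <= t e /\
    exists n, n <= t e /\ t e = <<k, <<m, n>>>>)).
  - b0.
  - intros e; split; [|intros (k & _ & m & _ & n & _ & H); exists k, m, n; exact H].
    intros (k & m & n & E); destruct (le_code k m n) as (Hk & Hm & Hn).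
    rewrite <- E in Hk, Hm, Hn; exists k; split; [exact Hk|].
    exists m; split; [exact Hm|]; exists n; auto.
Qed.

Lemma FinEq_bounded b c :
  (forall i, InFin i b <-> InFin i c) <->
  (forall i, i < b + c -> (InFin i b <-> InFin i c)).
Proof.
  split; [auto|intros H i].
  split; intros Hi; apply H; auto;
    apply (lt_le_trans _ _ _ (InFin_lt _ _ Hi)); [apply le_add_r|apply le_add_l].
Qed.

Lemma B0_FinEq t t' : Tm t -> Tm t' ->
  B0 (fun e => forall i, InFin i (t e) <-> InFin i (t' e)).
Proof.
  intros Ht Ht'.
  apply (B0_ext (fun e => forall i, i < t e + t' e ->
    (InFin i (t e) <-> InFin i (t' e)))).
  - b0; apply B0_InFin; tm.
  - intros e; apply FinEq_bounded.
Qed.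

Lemma B0_FinCode t : Tm t -> B0 (fun e => FinCode (t e)).
Proof.
  intros Ht; unfold FinCode.
  apply B0_and; [apply B0_FinRep, Ht|].
  b0; [apply B0_FinRep; tm|apply B0_FinEq; tm].
Qed.

Lemma fin_code_ext c c' : FinCode c -> FinCode c' ->
  (forall i, InFin i c <-> InFin i c') -> c = c'.
Proof.
  intros [R H] [R' H'] E; destruct (lt_total c c') as [L|[L|L]]; [exfalso|exact L|exfalso].
  - exact (H' c L R E).
  - apply (H c' L R'); intros i; symmetry; apply E.
Qed.

Lemma B0_pred (P : D -> Prop) t :
  B0 (fun e => P (e 0%nat)) -> Tm t -> B0 (fun e => P (t e)).
Proof.
  intros HP Ht; apply (B0_ext (fun e => exists x, x <= t e /\ x = t e /\ P x)).
  - b0.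
  - intros e; split; [intros H; exists (t e); auto|intros (x & _ & -> & H); exact H].
Qed.

Lemma B0_rel (R : D -> D -> Prop) t t' :
  B0 (fun e => R (e 0%nat) (e 1%nat)) -> Tm t -> Tm t' ->
  B0 (fun e => R (t e) (t' e)).
Proof.
  intros HR Ht Ht'.
  apply (B0_ext (fun e => exists y, y <= t' e /\
    exists x, x <= t e /\ x = t e /\ y = t' e /\ R x y)).
  - b0.
  - intros e; split; [|intros (y & _ & x & _ & -> & -> & H); exact H].
    intros H; exists (t' e); split; [auto|]; exists (t e); auto.
Qed.

(** The role played elsewhere by [k!]: only this divisibility makes the moduli
    below coprime, and no recursion is needed to obtain it. *)
Lemma common_multiple k : exists m, 0 < m /\ forall i, i < k -> dvd (i + 1) m.
Proof.
  revert k; apply sigma1_induction.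
  - b0; apply B0_dvd; tm.
  - exists 1; split; [apply lt01|intros i Hi; destruct (not_lt0 _ Hi)].
  - intros k (m & Hm & H); exists (m * (k + 1)); split.
    + exact (lt_le_trans _ _ _ Hm (le_mul_succ _ _)).
    + intros i Hi; apply lt_succ_le in Hi; destruct Hi as [Hi| ->].
      * apply dvd_mul_r, H, Hi.
      * exists m; ring.
Qed.

(** The moduli [m * (i + 1) + 1] are pairwise coprime in the form in which
    coprimality is used.  With [i + d = j], the combination
    [(j + 1) * p_i = (i + 1) * p_j + d] of two moduli shows that [p_i] divides
    [n * d], hence [n * m], hence [n], because [p_i] is [1] modulo [m]. *)
Lemma modulus_cancel k m n i j :
  (forall i, i < k -> dvd (i + 1) m) -> i < k -> j < k -> i <> j ->
  dvd (m * (i + 1) + 1) (n * (m * (j + 1) + 1)) -> dvd (m * (i + 1) + 1) n.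
Proof.
  intros Hm Hi Hj Hij H.
  set (p := m * (i + 1) + 1) in *; set (q := m * (j + 1) + 1) in *.
  assert (Hd : exists d, d < k /\ dvd p (n * (d + 1))).
  { destruct (lt_total i j) as [L|[L|L]]; [|contradiction|].
    - destruct (lt_diff_pos _ _ L) as [d Ed]; exists d; split.
      + apply succ_le_lt.
        eapply le_trans; [|left; exact Hj]; rewrite <- Ed; apply le_add_l.
      + apply (dvd_add_cancel _ _ (n * q * (i + 1))); [|apply dvd_mul_r, H].
        exists (n * (j + 1)); unfold p, q; rewrite <- Ed; ring.
    - destruct (lt_diff_pos _ _ L) as [d Ed]; exists d; split.
      + apply succ_le_lt.
        eapply le_trans; [|left; exact Hi]; rewrite <- Ed; apply le_add_l.
      + apply (dvd_add_cancel _ _ (p * (n * (j + 1)))); [|exists (n * (j + 1)); ring].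
        replace (n * (d + 1) + p * (n * (j + 1))) with (n * q * (i + 1))
          by (unfold p, q; rewrite <- Ed; ring).
        apply dvd_mul_r, H. }
  destruct Hd as (d & Hdk & Hd).
  destruct (Hm d Hdk) as [w Ew].
  apply (dvd_add_cancel _ _ (n * (d + 1) * (w * (i + 1)))); [|apply dvd_mul_r, Hd].
  exists n; unfold p; rewrite Ew; ring.
Qed.

(** [n] is the product of the moduli of the elements of the set, built up by
    induction on the part [i < j] of the segment dealt with: multiplying by the
    modulus of [j] makes it a divisor and affects divisibility by no other. *)
Lemma fin_rep_exists (P : D -> Prop) k :
  B0 (fun e => P (e 0%nat)) ->
  exists c, FinRep c /\ forall i, InFin i c <-> i < k /\ P i.
Proof.
  intros HP; destruct (common_multiple k) as (m & Hm0 & Hm).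
  assert (H : forall j, exists n, forall i, i < k ->
    (dvd (m * (i + 1) + 1) n <-> i < j /\ P i)).
  { apply sigma1_induction.
    - b0; apply B0_dvd; tm.
    - exists 1; intros i Hi; split; [|intros [H _]; destruct (not_lt0 _ H)].
      intros [d Ed]; exfalso.
      destruct (zero_or_succ d) as [->|[d' ->]].
      + rewrite mul0 in Ed; pose proof (@lt01 M _) as H; rewrite Ed in H.
        destruct (lt_irrefl _ H).
      + assert (H : 1 < (m * (i + 1) + 1)).
        { replace (1 : D) with (0 + 1 : D) at 1 by ring.
          apply lt_add, (lt_le_trans _ _ _ Hm0), le_mul_succ. }
        rewrite Ed in H at 1; exact (lt_not_le _ _ H (le_mul_succ _ _)).
    - intros j [n Hn].
      destruct (classic (j < k /\ P j)) as [[Hj Pj]|Hj].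
      + exists (n * (m * (j + 1) + 1)); intros i Hi.
        destruct (classic (i = j)) as [->|Hij].
        * split; [intros _; split; [apply lt_succ|exact Pj]|].
          intros _; exists n; ring.
        * rewrite lt_succ_le; split.
          -- intros Hd; apply (modulus_cancel k) in Hd; auto.
             apply Hn in Hd; tauto.
          -- intros [[L|L] Pi]; [|contradiction].
             apply dvd_mul_r, Hn; auto.
      + exists n; intros i Hi; rewrite Hn by exact Hi; rewrite lt_succ_le.
        split; [tauto|].
        intros [[L| ->] Pi]; [auto|tauto]. }
  destruct (H k) as [n Hn].
  exists <<k, <<m, n>>>>; split; [exists k, m, n; reflexivity|].
  intros i; rewrite InFin_pr; split; intros [Hi Hd].
  - apply Hn in Hd; auto.
  - split; [exact Hi|apply Hn; auto].
Qed.

Lemma fin_code_exists (P : D -> Prop) k :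
  B0 (fun e => P (e 0%nat)) ->
  exists c, FinCode c /\ forall i, InFin i c <-> i < k /\ P i.
Proof.
  intros HP; destruct (fin_rep_exists P k HP) as (c & Rc & Hc).
  destruct (delta0_least (fun b => FinRep b /\ forall i, InFin i b <-> InFin i c))
    as (b & [Rb Hb] & Hmin).
  - b0; [apply B0_FinRep; tm|apply B0_FinEq; tm].
  - exists c; split; [exact Rc|reflexivity].
  - exists b; split.
    + split; [exact Rb|]; intros a Hab Ra Ha; apply (Hmin a Hab); split; [exact Ra|].
      intros i; rewrite Ha; apply Hb.
    + intros i; rewrite Hb; apply Hc.
Qed.

End FiniteSets.

Ltac b0_atom ::=
  first [apply B0_InFin; tm | apply B0_FinCode; tm | apply B0_dvd; tm].

(** * Functions and increasing enumerations *)

Section Functions.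
Context {M : structure} {RM : RCA0_model M}.
Notation D := (dom M).
Implicit Types b c i j k m n r s t u v w x y z : D.
Implicit Types f h : sets M.
Add Ring model_ring : (@model_semiring M RM).

Definition Func (A C : D -> Prop) f : Prop :=
  (forall z, z \in f -> exists x y, A x /\ C y /\ z = <<x, y>>) /\
  (forall x, A x -> exists y, <<x, y>> \in f /\ forall w, <<x, w>> \in f -> w = y).

Definition Nats (_ : D) : Prop := (0 : D) = 0.

Lemma Func_dom (A C : D -> Prop) f x y : Func A C f -> <<x, y>> \in f -> A x /\ C y.
Proof.
  intros [H _] Hxy; destruct (H _ Hxy) as (x' & y' & Hx & Hy & E).
  apply pr_inj in E as [-> ->]; auto.
Qed.

Lemma Func_unique (A C : D -> Prop) f x y y' :
  Func A C f -> <<x, y>> \in f -> <<x, y'>> \in f -> y = y'.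
Proof.
  intros H Hy Hy'; destruct (Func_dom _ _ _ _ _ H Hy) as [Hx _].
  destruct (proj2 H x Hx) as (v & _ & Hv).
  rewrite (Hv y Hy), (Hv y' Hy'); reflexivity.
Qed.

(** The intermediate value [t] exists and is unique, so quantifying over it
    existentially or universally defines the same set. *)
Lemma Func_compose (A C : D -> Prop) h (R : D -> D -> Prop) :
  Func Nats A h ->
  B0 (fun e => R (e 0%nat) (e 1%nat)) ->
  (forall t, A t -> exists q, C q /\ R t q /\ forall q', R t q' -> q' = q) ->
  exists f, Func Nats C f /\
    forall n q, <<n, q>> \in f <-> exists t, <<n, t>> \in h /\ R t q.
Proof.
  intros Hh BR HR.
  destruct (delta1_comprehension
    (fun z t => exists n, n <= z /\ exists q, q <= z /\
       z = <<n, q>> /\ <<n, t>> \in h /\ R t q)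
    (fun z t => exists n, n <= z /\ exists q, q <= z /\
       z = <<n, q>> /\ (<<n, t>> \in h -> R t q))) as [f Hf].
  - b0; apply (B0_rel R _ _ BR); tm.
  - b0; apply (B0_rel R _ _ BR); tm.
  - intros z; split.
    + intros (t & n & Hn & q & Hq & Ez & Ht & HRt) t'.
      exists n; split; [exact Hn|]; exists q; split; [exact Hq|split; [exact Ez|]].
      intros Ht'; rewrite <- (Func_unique _ _ _ _ _ _ Hh Ht Ht'); exact HRt.
    + intros H; destruct (H 0) as (n & Hn & q & Hq & Ez & _).
      destruct (proj2 Hh n eq_refl) as (t & Ht & _).
      destruct (H t) as (n' & _ & q' & _ & Ez' & HRt).
      rewrite Ez in Ez'; apply pr_inj in Ez' as [<- <-].
      exists t, n; split; [exact Hn|]; exists q; auto.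
  - assert (Hfq : forall n q, <<n, q>> \in f <-> exists t, <<n, t>> \in h /\ R t q).
    { intros n q; rewrite Hf; split.
      - intros (t & n' & _ & q' & _ & E & H).
        apply pr_inj in E as [<- <-]; exists t; exact H.
      - intros (t & H); exists t, n; split; [apply le_pr_l|].
        exists q; split; [apply le_pr_r|auto]. }
    exists f; split; [split|exact Hfq].
    + intros z Hz; pose proof Hz as Hz'; apply Hf in Hz'.
      destruct Hz' as (t & n & _ & q & _ & -> & Ht & HRt).
      exists n, q; split; [reflexivity|split; [|reflexivity]].
      destruct (HR t (proj2 (Func_dom _ _ _ _ _ Hh Ht))) as (q' & Hq' & _ & Hu).
      rewrite (Hu q HRt); exact Hq'.
    + intros n _; destruct (proj2 Hh n eq_refl) as (t & Ht & _).
      destruct (HR t (proj2 (Func_dom _ _ _ _ _ Hh Ht))) as (q & Hq & HRq & Hu).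
      exists q; split; [apply Hfq; eauto|].
      intros q' Hq'; apply Hfq in Hq' as (t' & Ht' & HRt').
      rewrite (Func_unique _ _ _ _ _ _ Hh Ht' Ht) in HRt'; apply Hu, HRt'.
Qed.

Section Enumeration.
Variable P : D -> Prop.
Hypothesis BP : B0 (fun e => P (e 0%nat)).
Hypothesis P_unbounded : forall b, exists t, b <= t /\ P t.

Definition FirstFrom b s : Prop :=
  P s /\ b <= s /\ forall u, u < s -> b <= u -> ~ P u.

(** Finite approximations to the graph of the increasing enumeration of [P].  Each
    entry is justified by its predecessor, so an entry for [n] brings with it all
    earlier ones; members of [c] that are not pairs do no harm. *)
Definition Table c : Prop :=
  forall z, z < c -> InFin z c -> forall i, i <= z -> forall s, s <= z ->
  z = <<i, s>> ->
  i = 0 /\ FirstFrom 0 s \/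
  exists j, j < i /\ (i = j + 1 /\ exists r, r < s /\
    (InFin <<j, r>> c /\ FirstFrom (r + 1) s)).

Lemma B0_P (a : (nat -> D) -> D) : Tm a -> B0 (fun e => P (a e)).
Proof. apply B0_pred, BP. Qed.

Lemma B0_Table (a : (nat -> D) -> D) : Tm a -> B0 (fun e => Table (a e)).
Proof. intros Ha; unfold Table, FirstFrom; b0; apply B0_P; tm. Qed.

Lemma FirstFrom_exists b : exists s, FirstFrom b s.
Proof.
  destruct (delta0_least (fun s => P s /\ b <= s)) as (s & [Ps Hs] & Hmin).
  - b0.
  - destruct (P_unbounded b) as (t & Ht & Pt); eauto.
  - exists s; split; [exact Ps|split; [exact Hs|]].
    intros u Hu Hb Pu; exact (Hmin u Hu (conj Pu Hb)).
Qed.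

Lemma FirstFrom_unique b s s' : FirstFrom b s -> FirstFrom b s' -> s = s'.
Proof.
  intros (Ps & Hs & Ms) (Ps' & Hs' & Ms'); destruct (lt_total s s') as [L|[L|L]].
  - destruct (Ms' s L Hs Ps).
  - exact L.
  - destruct (Ms s' L Hs' Ps').
Qed.

Lemma Table_entry c i s : Table c -> InFin <<i, s>> c ->
  i = 0 /\ FirstFrom 0 s \/
  exists j r, i = j + 1 /\ r < s /\ InFin <<j, r>> c /\ FirstFrom (r + 1) s.
Proof.
  intros Hc Hi.
  destruct (Hc _ (InFin_lt _ _ Hi) Hi i (le_pr_l _ _) s (le_pr_r _ _) eq_refl)
    as [H|(j & _ & Ei & r & Hr & H)]; [left; exact H|right; eauto 6].
Qed.

Lemma entry_lt c n t : InFin <<n, t>> c -> t < c.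
Proof. intros H; exact (le_lt_trans _ _ _ (le_pr_r n t) (InFin_lt _ _ H)). Qed.

Lemma Table_unique c c' n t t' : Table c -> Table c' ->
  InFin <<n, t>> c -> InFin <<n, t'>> c' -> t = t'.
Proof.
  intros Hc Hc' Ht Ht'.
  assert (H : forall n t, t < c -> forall t', t' < c' ->
    InFin <<n, t>> c -> InFin <<n, t'>> c' -> t = t').
  { clear n t t' Ht Ht'; 
    apply (delta0_induction (fun n => forall t, t < c -> forall t', t' < c' ->
      InFin <<n, t>> c -> InFin <<n, t'>> c' -> t = t')).
    - b0.
    - intros t _ t' _ Ht Ht'.
      destruct (Table_entry _ _ _ Hc Ht) as [[_ H]|(j & r & E & _)];
        [|symmetry in E; destruct (succ_neq0 _ E)].
      destruct (Table_entry _ _ _ Hc' Ht') as [[_ H']|(j & r & E & _)];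
        [|symmetry in E; destruct (succ_neq0 _ E)].
      exact (FirstFrom_unique _ _ _ H H').
    - intros n IH t _ t' _ Ht Ht'.
      destruct (Table_entry _ _ _ Hc Ht) as [[E _]|(j & r & E & Hr & Hin & H)];
        [destruct (succ_neq0 _ E)|].
      destruct (Table_entry _ _ _ Hc' Ht') as [[E' _]|(j' & r' & E' & Hr' & Hin' & H')];
        [destruct (succ_neq0 _ E')|].
      apply add_cancel in E as <-; apply add_cancel in E' as <-.
      rewrite (IH r (entry_lt _ _ _ Hin) r' (entry_lt _ _ _ Hin') Hin Hin') in H.
      exact (FirstFrom_unique _ _ _ H H'). }
  exact (H n t (entry_lt _ _ _ Ht) t' (entry_lt _ _ _ Ht') Ht Ht').
Qed.

Lemma Table_exists n : exists c, exists t, t < c /\ (Table c /\ InFin <<n, t>> c).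
Proof.
  revert n; apply sigma1_induction.
  - b0; apply B0_Table; tm.
  - destruct (FirstFrom_exists 0) as [s Hs].
    destruct (fin_code_exists (fun z => z = <<0, s>>) (<<0, s>> + 1)) as (c & _ & Hc);
      [b0|].
    assert (Hin : InFin <<0, s>> c) by (apply Hc; split; [apply lt_succ|reflexivity]).
    exists c, s; split; [exact (entry_lt _ _ _ Hin)|split; [|exact Hin]].
    intros z _ Hz i _ s' _ E; apply Hc in Hz as [_ Hz]; rewrite Hz in E.
    apply pr_inj in E as [<- <-]; left; auto.
  - intros n (c & t & _ & Hc & Ht).
    destruct (FirstFrom_exists (t + 1)) as [s Hs].
    assert (Hts : t < s) by (apply succ_le_lt, Hs).
    destruct (fin_code_exists (fun z => InFin z c \/ z = <<n + 1, s>>)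
      (<<n + 1, s>> + c + 1)) as (c' & _ & Hc'); [b0|].
    assert (Hin : InFin <<n + 1, s>> c').
    { apply Hc'; split; [apply lt_succ_le, le_add_r|auto]. }
    assert (Hold : forall z, InFin z c -> InFin z c').
    { intros z Hz; apply Hc'; split; [|auto].
      apply lt_succ_le; left.
      apply (lt_le_trans _ _ _ (InFin_lt _ _ Hz)), le_add_l. }
    exists c', s; split; [exact (entry_lt _ _ _ Hin)|split; [|exact Hin]].
    intros z _ Hz i _ s' _ E; apply Hc' in Hz as [_ [Hz|Hz]]; rewrite E in Hz.
    + destruct (Table_entry _ _ _ Hc Hz) as [H|(j & r & -> & Hr & Hj & H)]; [auto|].
      right; exists j; split; [apply lt_succ|split; [reflexivity|]].
      exists r; auto.
    + apply pr_inj in Hz as [-> ->]; right.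
      exists n; split; [apply lt_succ|split; [reflexivity|]].
      exists t; auto.
Qed.

(** Primitive recursion in the only instance required.  Tables exist for every
    [n] by [Sigma1] induction and agree with one another, so that some table
    lists [<<n, t>>] if and only if no table lists another value at [n]; the
    graph is therefore given by comprehension. *)
Lemma increasing_enumeration : exists h, Func Nats P h /\
  forall m n s t, m < n -> <<m, s>> \in h -> <<n, t>> \in h -> s < t.
Proof.
  destruct (delta1_comprehension
    (fun z c => exists n, n <= z /\ exists t, t <= z /\
       z = <<n, t>> /\ Table c /\ InFin <<n, t>> c)
    (fun z c => exists n, n <= z /\ exists t, t <= z /\
       z = <<n, t>> /\ (Table c -> forall t', t' < c -> InFin <<n, t'>> c -> t = t')))
    as [h Hh].
  - b0; apply B0_Table; tm.
  - b0; apply B0_Table; tm.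
  - intros z; split.
    + intros (c & n & Hn & t & Ht & Ez & Hc & Hin) c'.
      exists n; split; [exact Hn|]; exists t; split; [exact Ht|split; [exact Ez|]].
      intros Hc' t' _ Hin'; exact (Table_unique _ _ _ _ _ Hc Hc' Hin Hin').
    + intros H; destruct (H 0) as (n & Hn & t & Ht & Ez & _).
      destruct (Table_exists n) as (c & t' & Hlt & Hc & Hin).
      destruct (H c) as (n' & _ & t'' & _ & Ez' & Hu).
      rewrite Ez in Ez'; apply pr_inj in Ez' as [<- <-].
      exists c, n; split; [exact Hn|]; exists t; split; [exact Ht|].
      rewrite (Hu Hc t' Hlt Hin); rewrite (Hu Hc t' Hlt Hin) in Ez; auto.
  - assert (Hht : forall n t, <<n, t>> \in h <-> exists c, Table c /\ InFin <<n, t>> c).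
    { intros n t; rewrite Hh; split.
      - intros (c & n' & _ & t' & _ & E & H).
        apply pr_inj in E as [<- <-]; exists c; exact H.
      - intros (c & H); exists c, n; split; [apply le_pr_l|].
        exists t; split; [apply le_pr_r|auto]. }
    assert (Htotal : forall n, exists t, <<n, t>> \in h).
    { intros n; destruct (Table_exists n) as (c & t & _ & H).
      exists t; apply Hht; eauto. }
    assert (Hunique : forall n t t', <<n, t>> \in h -> <<n, t'>> \in h -> t = t').
    { intros n t t' H H'; apply Hht in H as (c & Hc & H).
      apply Hht in H' as (c' & Hc' & H'); exact (Table_unique _ _ _ _ _ Hc Hc' H H'). }
    exists h; split; [split|].
    + intros z Hz; pose proof Hz as Hz'; apply Hh in Hz'.
      destruct Hz' as (c & n & _ & t & _ & -> & Hc & Hin).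
      exists n, t; split; [reflexivity|split; [|reflexivity]].
      destruct (Table_entry _ _ _ Hc Hin) as [[_ H]|(j & r & _ & _ & _ & H)]; apply H.
    + intros n _; destruct (Htotal n) as [t Ht]; exists t; split; [exact Ht|].
      intros t' Ht'; exact (Hunique _ _ _ Ht' Ht).
    + intros m n s t Hmn Hs Ht.
      assert (H : exists t, <<n, t>> \in h /\ (m < n -> s < t)).
      { clear t Ht Hmn; revert n; apply sigma1_induction.
        - b0.
        - destruct (Htotal 0) as [t Ht]; exists t; split; [exact Ht|].
          intros Hm; destruct (not_lt0 _ Hm).
        - intros n (t & Ht & H); destruct (Htotal (n + 1)) as [t' Ht'].
          exists t'; split; [exact Ht'|intros Hm].
          apply Hht in Ht' as (c & Hc & Hin).
          destruct (Table_entry _ _ _ Hc Hin) as [[E _]|(j & r & E & Hr & Hj & _)];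
            [destruct (succ_neq0 _ E)|].
          apply add_cancel in E as <-.
          assert (Hrh : <<n, r>> \in h) by (apply Hht; eauto).
          apply lt_succ_le in Hm as [Hm| ->].
          + rewrite (Hunique _ _ _ Hrh Ht) in Hr; exact (lt_trans _ _ _ (H Hm) Hr).
          + rewrite (Hunique _ _ _ Hs Hrh); exact Hr. }
      destruct H as (t' & Ht' & H); rewrite (Hunique _ _ _ Ht Ht'); exact (H Hmn).
Qed.

End Enumeration.
End Functions.

(** * Quasi-orders and their spaces *)

Section Spaces.
Context {M : structure} {RM : RCA0_model M}.
Notation D := (dom M).
Implicit Types b c i j m n p q r s t u v w x y z N : D.
Implicit Types Q le X Y I U V f g h k l : sets M.
Add Ring model_ring : (@model_semiring M RM).

(** The definitions from here to [UNoetherian] are the meanings, in a structure,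
    of the formulas with corresponding names; their clauses come in the same order
    so that the two can be matched connective by connective. *)
Definition PFin Y c : Prop := FinCode c /\ forall i, InFin i c -> i \in Y.

Definition NatPairs z : Prop := exists n m, z = <<n, m>>.

Definition QuasiOrder Q le : Prop :=
  (forall z, z \in le -> exists p q, p \in Q /\ q \in Q /\ z = <<p, q>>) /\
  (forall q, q \in Q -> <<q, q>> \in le) /\
  (forall p q r, <<p, q>> \in le /\ <<q, r>> \in le -> <<p, r>> \in le).

Definition WQO Q le : Prop :=
  QuasiOrder Q le /\
  forall f, Func Nats (fun x => x \in Q) f ->
    exists m n, m < n /\
      exists p q, <<m, p>> \in f /\ <<n, q>> \in f /\ <<p, q>> \in le.

Definition CscSpace X I U k : Prop :=
  (forall z, z \in U -> exists i x, i \in I /\ x \in X /\ z = <<i, x>>) /\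
  Func (fun z => exists x i j, x \in X /\ i \in I /\ j \in I /\ z = <<x, <<i, j>>>>)
    (fun i => i \in I) k /\
  (forall x, x \in X -> exists i, i \in I /\ <<i, x>> \in U) /\
  (forall x i j, <<i, x>> \in U /\ <<j, x>> \in U ->
     exists m, <<<<x, <<i, j>>>>, m>> \in k /\ <<m, x>> \in U /\
       forall y, <<m, y>> \in U -> <<i, y>> \in U /\ <<j, y>> \in U).

Definition InOpen U g n x : Prop :=
  exists m c, <<<<n, m>>, c>> \in g /\ exists i, InFin i c /\ <<i, x>> \in U.

Definition InClosed X U g n x : Prop := x \in X /\ ~ InOpen U g n x.

Definition Noetherian X I U k : Prop :=
  CscSpace X I U k /\
  forall g, Func NatPairs (PFin I) g ->
    (forall n x, InClosed X U g (n + 1) x -> InClosed X U g n x) ->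
    exists N, forall n, N < n ->
      forall x, InClosed X U g n x <-> InClosed X U g N x.

Definition Alexandroff Q le U k : Prop :=
  (forall z, z \in U <->
     exists q p, q \in Q /\ p \in Q /\ <<q, p>> \in le /\ z = <<q, p>>) /\
  (forall z, z \in k <->
     exists q p r, q \in Q /\ p \in Q /\ r \in Q /\ z = <<<<q, <<p, r>>>>, q>>).

Definition Down Q le i q : Prop :=
  q \in Q /\ exists p, InFin p i /\ <<q, p>> \in le.

Definition Upper Q le I V l : Prop :=
  (forall i, i \in I <-> PFin Q i) /\
  (forall z, z \in V <->
     exists i q, i \in I /\ q \in Q /\ ~ Down Q le i q /\ z = <<i, q>>) /\
  (forall z, z \in l <->
     exists q i j u, q \in Q /\ i \in I /\ j \in I /\ FinCode u /\
       (forall p, InFin p u <-> InFin p i \/ InFin p j) /\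
       z = <<<<q, <<i, j>>>>, u>>).

Definition ANoetherian Q le : Prop :=
  exists U k, Alexandroff Q le U k /\ Noetherian Q Q U k.

Definition UNoetherian Q le : Prop :=
  exists I V l, Upper Q le I V l /\ Noetherian Q I V l.

(** ** Effectively open sets *)

(** The bounded stages of the [Sigma1] relation [InOpen]. *)
Definition InOpenBy U g n x w : Prop :=
  exists m, m <= w /\ exists c, c <= w /\ (<<<<n, m>>, c>> \in g /\
    exists i, i <= w /\ (InFin i c /\ <<i, x>> \in U)).

Lemma InOpen_stage U g n x : InOpen U g n x <-> exists w, InOpenBy U g n x w.
Proof.
  split.
  - intros (m & c & Hg & i & Hi & Hx).
    exists (m + c); exists m; split; [apply le_add_r|].
    exists c; split; [apply le_add_l|split; [exact Hg|]].
    exists i; split; [left; apply (lt_le_trans _ _ _ (InFin_lt _ _ Hi)), le_add_l|auto].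
  - intros (w & m & _ & c & _ & Hg & i & _ & Hi & Hx).
    exists m, c; split; [exact Hg|]; exists i; auto.
Qed.

Lemma InOpenBy_mono U g n x w w' :
  w <= w' -> InOpenBy U g n x w -> InOpenBy U g n x w'.
Proof.
  intros Hw (m & Hm & c & Hc & Hg & i & Hi & H).
  exists m; split; [exact (le_trans _ _ _ Hm Hw)|].
  exists c; split; [exact (le_trans _ _ _ Hc Hw)|split; [exact Hg|]].
  exists i; split; [exact (le_trans _ _ _ Hi Hw)|exact H].
Qed.

Lemma B0_InOpenBy U g (a b c : (nat -> D) -> D) : Tm a -> Tm b -> Tm c ->
  B0 (fun e => InOpenBy U g (a e) (b e) (c e)).
Proof. intros Ha Hb Hc; unfold InOpenBy; b0. Qed.

Lemma InOpen_mono X U g n n' x :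
  (forall n x, InClosed X U g (n + 1) x -> InClosed X U g n x) ->
  x \in X -> n <= n' -> InOpen U g n x -> InOpen U g n' x.
Proof.
  intros Hg Hx Hn H; destruct (le_diff _ _ Hn) as [d <-].
  apply InOpen_stage; clear Hn; revert d.
  apply sigma1_induction.
  - apply B0_InOpenBy; tm.
  - rewrite add0; apply InOpen_stage, H.
  - intros d Hd; apply InOpen_stage, NNPP; intros Hn.
    apply (Hg (n + d) x); [|apply InOpen_stage, Hd].
    split; [exact Hx|]; rewrite addA; exact Hn.
Qed.

(** When the indices of the basic open sets forming the [n]-th open set are
    decidable, an index [m] can itself serve as the stage: the value at [(n, m)]
    is the singleton of [m] if [m] is such an index, and empty otherwise. *)
Lemma open_code_exists I (E : D -> D -> Prop) :
  B0 (fun e => E (e 0%nat) (e 1%nat)) ->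
  (forall n i, E n i -> i \in I) ->
  exists g, Func NatPairs (PFin I) g /\
    forall U n x, InOpen U g n x <-> exists i, E n i /\ <<i, x>> \in U.
Proof.
  intros BE EI.
  set (code n m c := FinCode c /\ (forall i, i < c -> InFin i c -> i = m /\ E n m) /\
    (E n m -> InFin m c)).
  assert (Hcode : forall n m c,
    code n m c <-> FinCode c /\ forall i, InFin i c <-> i = m /\ E n m).
  { intros n m c; split.
    - intros (Fc & H1 & H2); split; [exact Fc|]; intros i; split.
      + intros Hi; exact (H1 i (InFin_lt _ _ Hi) Hi).
      + intros [-> He]; auto.
    - intros [Fc H]; split; [exact Fc|split]; [intros i _; apply H|].
      intros He; apply H; auto. }
  destruct (delta0_comprehension (fun z => exists n, n <= z /\ exists m, m <= z /\
    exists c, c <= z /\ (z = <<<<n, m>>, c>> /\ code n m c))) as [g Hg].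
  { unfold code; b0; apply (B0_rel E _ _ BE); tm. }
  assert (Hgc : forall n m c, <<<<n, m>>, c>> \in g <-> code n m c).
  { intros n m c; rewrite Hg; split.
    - intros (n' & _ & m' & _ & c' & _ & Ez & H).
      apply pr_inj in Ez as [Ez <-]; apply pr_inj in Ez as [<- <-]; exact H.
    - intros H; exists n; split; [exact (le_trans _ _ _ (le_pr_l n m) (le_pr_l _ _))|].
      exists m; split; [exact (le_trans _ _ _ (le_pr_r n m) (le_pr_l _ _))|].
      exists c; split; [apply le_pr_r|auto]. }
  exists g; split; [split|].
  - intros z Hz; pose proof Hz as Hz'; apply Hg in Hz'.
    destruct Hz' as (n & _ & m & _ & c & _ & -> & Hc); apply Hcode in Hc as [Fc Hc].
    exists <<n, m>>, c; split; [exists n, m; reflexivity|split; [|reflexivity]].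
    split; [exact Fc|intros i Hi; apply Hc in Hi as [-> He]; eapply EI, He].
  - intros z (n & m & ->).
    destruct (fin_code_exists (fun i => i = m /\ E n m) (m + 1)) as (c & Fc & Hc).
    { b0; apply (B0_rel E (fun _ => n) (fun _ => m) BE); tm. }
    exists c; split.
    + apply Hgc, Hcode; split; [exact Fc|]; intros i; rewrite Hc.
      split; [tauto|]; intros [-> He]; split; [apply lt_succ|auto].
    + intros c' Hc'; apply Hgc, Hcode in Hc' as [Fc' Hc'].
      apply (fin_code_ext _ _ Fc' Fc); intros i; rewrite Hc', Hc.
      split; [|tauto]; intros [-> He]; split; [apply lt_succ|auto].
  - intros U n x; split.
    + intros (m & c & Hc & i & Hi & Hx); apply Hgc, Hcode in Hc as [_ Hc].
      apply Hc in Hi as [-> He]; eauto.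
    + intros (i & He & Hx).
      destruct (fin_code_exists (fun j => j = i) (i + 1)) as (c & Fc & Hc); [b0|].
      exists i, c; split.
      * apply Hgc, Hcode; split; [exact Fc|]; intros j; rewrite Hc.
        split; [tauto|]; intros [-> _]; split; [apply lt_succ|auto].
      * exists i; split; [apply Hc; split; [apply lt_succ|reflexivity]|exact Hx].
Qed.

(** ** The Alexandroff and the upper space *)

Lemma alexandroff_exists Q le : exists U k, Alexandroff Q le U k.
Proof.
  destruct (delta0_comprehension (fun z => exists q, q <= z /\ exists p, p <= z /\
    (q \in Q /\ p \in Q /\ <<q, p>> \in le /\ z = <<q, p>>))) as [U HU]; [b0|].
  destruct (delta0_comprehension (fun z => exists q, q <= z /\ exists p, p <= z /\
    exists r, r <= z /\
    (q \in Q /\ p \in Q /\ r \in Q /\ z = <<<<q, <<p, r>>>>, q>>))) as [k Hk]; [b0|].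
  exists U, k; split; intros z; [rewrite HU|rewrite Hk]; split.
  - intros (q & _ & p & _ & H); eauto.
  - intros (q & p & Hq & Hp & Hle & ->).
    exists q; split; [apply le_pr_l|]; exists p; split; [apply le_pr_r|auto].
  - intros (q & _ & p & _ & r & _ & H); eauto.
  - intros (q & p & r & Hq & Hp & Hr & ->).
    assert (L : <<p, r>> <= <<<<q, <<p, r>>>>, q>>)
      by (eapply le_trans; [|apply le_pr_l]; apply le_pr_r).
    exists q; split; [apply le_pr_r|].
    exists p; split; [exact (le_trans _ _ _ (le_pr_l _ _) L)|].
    exists r; split; [exact (le_trans _ _ _ (le_pr_r _ _) L)|auto].
Qed.

Lemma alexandroff_mem Q le U k q p : QuasiOrder Q le -> Alexandroff Q le U k ->
  <<q, p>> \in U <-> <<q, p>> \in le.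
Proof.
  intros HQ [HU _]; rewrite HU; split.
  - intros (q' & p' & _ & _ & H & E); rewrite E; exact H.
  - intros H; destruct (proj1 HQ _ H) as (q' & p' & Hq & Hp & E).
    pose proof E as E'; apply pr_inj in E' as [-> ->]; eauto 6.
Qed.

Lemma QuasiOrder_dom Q le p q : QuasiOrder Q le -> <<p, q>> \in le -> p \in Q /\ q \in Q.
Proof.
  intros HQ H; destruct (proj1 HQ _ H) as (q' & p' & Hq & Hp & E).
  apply pr_inj in E as [-> ->]; auto.
Qed.

Lemma alexandroff_space Q le U k :
  QuasiOrder Q le -> Alexandroff Q le U k -> CscSpace Q Q U k.
Proof.
  intros HQ HA.
  assert (HU : forall q p, <<q, p>> \in U <-> <<q, p>> \in le)
    by (intros; eapply alexandroff_mem; eauto).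
  pose proof HQ as (HQd & HQr & HQt); destruct HA as [HU' Hk].
  assert (Hkp : forall x i j q, <<<<x, <<i, j>>>>, q>> \in k <->
    (x \in Q /\ i \in Q /\ j \in Q) /\ q = x).
  { intros x i j q; rewrite Hk; split.
    - intros (q' & p & r & Hq & Hp & Hr & Ez); apply pr_inj in Ez as [Ez ->].
      apply pr_inj in Ez as [-> Ez]; apply pr_inj in Ez as [-> ->]; auto.
    - intros [(Hx & Hi & Hj) ->]; exists x, i, j; auto. }
  split; [|split; [split|split]].
  - intros z Hz; apply HU' in Hz as (q & p & Hq & Hp & _ & ->).
    exists q, p; auto.
  - intros z Hz; apply Hk in Hz as (q & p & r & Hq & Hp & Hr & ->).
    exists <<q, <<p, r>>>>, q; split; [exists q, p, r; auto|auto].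
  - intros z (x & i & j & Hx & Hi & Hj & ->); exists x; split.
    + apply Hkp; auto.
    + intros w Hw; apply Hkp in Hw; tauto.
  - intros x Hx; exists x; split; [exact Hx|apply HU, HQr, Hx].
  - intros x i j [Hix Hjx]; apply HU in Hix; apply HU in Hjx.
    destruct (QuasiOrder_dom _ _ _ _ HQ Hix) as [Hi Hx].
    destruct (QuasiOrder_dom _ _ _ _ HQ Hjx) as [Hj _].
    exists x; split; [apply Hkp; auto|split; [apply HU, HQr, Hx|]].
    intros y Hy; apply HU in Hy; split; apply HU.
    + exact (HQt _ _ _ (conj Hix Hy)).
    + exact (HQt _ _ _ (conj Hjx Hy)).
Qed.

Lemma Down_bounded Q le i q : Down Q le i q <->
  q \in Q /\ exists p, p < i /\ (InFin p i /\ <<q, p>> \in le).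
Proof.
  split; intros [Hq (p & H)]; (split; [exact Hq|]); exists p.
  - split; [apply InFin_lt, H|exact H].
  - apply H.
Qed.

Lemma B0_Down Q le (a b : (nat -> D) -> D) :
  Tm a -> Tm b -> B0 (fun e => Down Q le (a e) (b e)).
Proof.
  intros Ha Hb.
  apply (B0_ext (fun e => b e \in Q /\
    exists p, p < a e /\ (InFin p (a e) /\ <<b e, p>> \in le))); [b0|].
  intros e; apply Down_bounded.
Qed.

Definition IsUnion i j u : Prop :=
  FinCode u /\ forall p, InFin p u <-> InFin p i \/ InFin p j.

Lemma B0_IsUnion (a b c : (nat -> D) -> D) : Tm a -> Tm b -> Tm c ->
  B0 (fun e => IsUnion (a e) (b e) (c e)).
Proof.
  intros Ha Hb Hc.
  apply (B0_ext (fun e => FinCode (c e) /\ forall p, p < a e + b e + c e ->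
    (InFin p (c e) <-> InFin p (a e) \/ InFin p (b e)))); [b0|].
  intros e; split; intros [F H]; split; auto.
  intros p; split; intros Hp; apply H; auto.
  - apply (lt_le_trans _ _ _ (InFin_lt _ _ Hp)), le_add_l.
  - destruct Hp as [Hp|Hp]; apply (lt_le_trans _ _ _ (InFin_lt _ _ Hp)).
    + rewrite addA; apply le_add_r.
    + rewrite (addC (a e)), addA; apply le_add_r.
Qed.

Lemma union_exists i j : exists u, IsUnion i j u.
Proof.
  destruct (fin_code_exists (fun p => InFin p i \/ InFin p j) (i + j))
    as (u & Fu & Hu); [b0|].
  exists u; split; [exact Fu|]; intros p; rewrite Hu; split; [tauto|intros Hp].
  split; [|exact Hp].
  destruct Hp as [Hp|Hp]; apply (lt_le_trans _ _ _ (InFin_lt _ _ Hp));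
    [apply le_add_r|apply le_add_l].
Qed.

Lemma upper_exists Q le : exists I V l, Upper Q le I V l.
Proof.
  destruct (delta0_comprehension (fun i => FinCode i /\
    forall p, p < i -> (InFin p i -> p \in Q))) as [I HI]; [b0|].
  destruct (delta0_comprehension (fun z => exists i, i <= z /\ exists q, q <= z /\
    (i \in I /\ q \in Q /\ ~ Down Q le i q /\ z = <<i, q>>))) as [V HV];
    [b0; apply B0_Down; tm|].
  destruct (delta0_comprehension (fun z => exists q, q <= z /\ exists i, i <= z /\
    exists j, j <= z /\ exists u, u <= z /\ (q \in Q /\ i \in I /\ j \in I /\
      IsUnion i j u /\ z = <<<<q, <<i, j>>>>, u>>))) as [l Hl];
    [b0; apply B0_IsUnion; tm|].
  exists I, V, l; split; [|split].
  - intros i; rewrite HI; split; intros [F H]; (split; [exact F|]); intros p; auto.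
    intros Hp; exact (H p (InFin_lt _ _ Hp) Hp).
  - intros z; rewrite HV; split.
    + intros (i & _ & q & _ & H); eauto.
    + intros (i & q & Hi & Hq & Hd & ->).
      exists i; split; [apply le_pr_l|]; exists q; split; [apply le_pr_r|auto].
  - intros z; rewrite Hl; split.
    + intros (q & _ & i & _ & j & _ & u & _ & Hq & Hi & Hj & [F Hu] & E).
      exists q, i, j, u; auto 6.
    + intros (q & i & j & u & Hq & Hi & Hj & F & Hu & ->).
      assert (L : <<q, <<i, j>>>> <= <<<<q, <<i, j>>>>, u>>) by apply le_pr_l.
      assert (L' : <<i, j>> <= <<<<q, <<i, j>>>>, u>>)
        by exact (le_trans _ _ _ (le_pr_r _ _) L).
      exists q; split; [exact (le_trans _ _ _ (le_pr_l _ _) L)|].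
      exists i; split; [exact (le_trans _ _ _ (le_pr_l _ _) L')|].
      exists j; split; [exact (le_trans _ _ _ (le_pr_r _ _) L')|].
      exists u; split; [apply le_pr_r|].
      split; [exact Hq|split; [exact Hi|split; [exact Hj|split; [split; auto|reflexivity]]]].
Qed.

Lemma upper_mem Q le I V l i q : Upper Q le I V l ->
  <<i, q>> \in V <-> i \in I /\ q \in Q /\ ~ Down Q le i q.
Proof.
  intros (_ & HV & _); rewrite HV; split.
  - intros (i' & q' & Hi & Hq & Hd & E); apply pr_inj in E as [-> ->]; auto.
  - intros (Hi & Hq & Hd); eauto 6.
Qed.

Lemma upper_space Q le I V l :
  QuasiOrder Q le -> Upper Q le I V l -> CscSpace Q I V l.
Proof.
  intros HQ HUp.
  assert (HV : forall i q, <<i, q>> \in V <-> i \in I /\ q \in Q /\ ~ Down Q le i q)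
    by (intros; eapply upper_mem; eauto).
  destruct HUp as (HI & HV' & Hl).
  assert (Hlu : forall q i j u, <<<<q, <<i, j>>>>, u>> \in l <->
    (q \in Q /\ i \in I /\ j \in I) /\ IsUnion i j u).
  { intros q i j u; rewrite Hl; split.
    - intros (q' & i' & j' & u' & Hq & Hi & Hj & F & Hu & E).
      apply pr_inj in E as [E ->]; apply pr_inj in E as [-> E].
      apply pr_inj in E as [-> ->]; split; [auto|split; auto].
    - intros [(Hq & Hi & Hj) [F Hu]]; exists q, i, j, u; auto 7. }
  assert (HuI : forall i j u, i \in I -> j \in I -> IsUnion i j u -> u \in I).
  { intros i j u Hi Hj [F Hu]; apply HI; split; [exact F|].
    intros p Hp; apply Hu in Hp as [Hp|Hp].
    - apply HI in Hi; apply Hi, Hp.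
    - apply HI in Hj; apply Hj, Hp. }
  split; [|split; [split|split]].
  - intros z Hz; apply HV' in Hz as (i & q & Hi & Hq & _ & ->); eauto.
  - intros z Hz; apply Hl in Hz as (q & i & j & u & Hq & Hi & Hj & F & Hu & ->).
    exists <<q, <<i, j>>>>, u; split; [exists q, i, j; auto|split; [|reflexivity]].
    apply (HuI i j); auto; split; auto.
  - intros z (q & i & j & Hq & Hi & Hj & ->).
    destruct (union_exists i j) as [u Hu]; exists u; split; [apply Hlu; auto|].
    intros u' Hu'; apply Hlu in Hu' as [_ [F' Hu']]; destruct Hu as [F Hu].
    apply (fin_code_ext _ _ F' F); intros p; rewrite Hu, Hu'; reflexivity.
  - intros x Hx.
    destruct (fin_code_exists (fun _ => (0 : D) < 0) 0) as (c & F & Hc); [b0|].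
    assert (He : forall p, ~ InFin p c)
      by (intros p Hp; apply Hc in Hp as [Hp _]; exact (not_lt0 _ Hp)).
    assert (HcI : c \in I)
      by (apply HI; split; [exact F|intros p Hp; destruct (He p Hp)]).
    exists c; split; [exact HcI|]; apply HV; split; [exact HcI|split; [exact Hx|]].
    intros [_ (p & Hp & _)]; exact (He p Hp).
  - intros x i j [Hix Hjx].
    apply HV in Hix as (Hi & Hx & Hdi); apply HV in Hjx as (Hj & _ & Hdj).
    destruct (union_exists i j) as [u Hu]; exists u.
    pose proof (HuI _ _ _ Hi Hj Hu) as HuI'.
    split; [apply Hlu; auto|]; destruct Hu as [F Hu]; split.
    + apply HV; split; [exact HuI'|split; [exact Hx|]].
      intros [_ (p & Hp & Hle)]; apply Hu in Hp as [Hp|Hp];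
        [apply Hdi|apply Hdj]; (split; [exact Hx|]); exists p; auto.
    + intros y Hy; apply HV in Hy as (_ & Hy & Hd).
      split; apply HV; (split; [assumption|split; [assumption|]]);
        intros [_ (p & Hp & Hle)]; apply Hd; (split; [exact Hy|]); exists p;
        (split; [apply Hu; auto|exact Hle]).
Qed.

(** ** The three implications *)

(** For a decreasing sequence of closed sets only the inclusion of the later
    open sets in a fixed one has to be shown. *)
Lemma stabilises X U g N :
  (forall n x, InClosed X U g (n + 1) x -> InClosed X U g n x) ->
  (forall n x, N < n -> x \in X -> InOpen U g n x -> InOpen U g N x) ->
  forall n, N < n -> forall x, InClosed X U g n x <-> InClosed X U g N x.
Proof.
  intros Hg H n Hn x; split; intros [Hx Ho]; (split; [exact Hx|]); intros Ho'; apply Ho.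
  - exact (InOpen_mono X U g N n x Hg Hx (or_introl Hn) Ho').
  - exact (H n x Hn Hx Ho').
Qed.

(** The pairs [<<w, q>>] list the indices [q] occurring in the code of the
    sequence, with [w] bounding the place of the occurrence: listing is decidable,
    and the index of an element also bounds the number [n] of an open set that
    contains it. *)
Definition Enumerated g t q : Prop :=
  exists w, w <= t /\ (t = <<w, q>> /\ exists n, n <= w /\
    exists m, m <= w /\ exists c, c <= w /\ (<<<<n, m>>, c>> \in g /\ InFin q c)).

(** The elements with new indices, in the order of the indices, form a bad
    sequence. *)
Definition NewIndex le g t : Prop :=
  exists q, q <= t /\ (Enumerated g t q /\ forall s, s < t -> forall p, p <= s ->
    (Enumerated g s p -> ~ <<p, q>> \in le)).

Lemma B0_Enumerated g (a b : (nat -> D) -> D) : Tm a -> Tm b ->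
  B0 (fun e => Enumerated g (a e) (b e)).
Proof. intros Ha Hb; unfold Enumerated; b0. Qed.

Lemma Enumerated_le g t q : Enumerated g t q -> q <= t.
Proof. intros (w & _ & -> & _); apply le_pr_r. Qed.

Lemma Enumerated_unique g t q q' : Enumerated g t q -> Enumerated g t q' -> q = q'.
Proof.
  intros (w & _ & -> & _) (w' & _ & E & _); apply pr_inj in E; tauto.
Qed.

Lemma InOpen_Enumerated U g n x : InOpen U g n x ->
  exists t q, Enumerated g t q /\ <<q, x>> \in U.
Proof.
  intros (m & c & Hg & q & Hq & Hx); exists <<n + (m + c), q>>, q.
  split; [|exact Hx]; exists (n + (m + c)); split; [apply le_pr_l|split; [reflexivity|]].
  exists n; split; [apply le_add_r|].
  exists m; split; [eapply le_trans; [|apply le_add_l]; apply le_add_r|].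
  exists c; split; [eapply le_trans; [|apply le_add_l]; apply le_add_l|auto].
Qed.

Lemma Enumerated_InOpen U g t q x : Enumerated g t q -> <<q, x>> \in U ->
  exists n, n <= t /\ InOpen U g n x.
Proof.
  intros (w & Hw & _ & n & Hn & m & _ & c & _ & Hg & Hq) Hx.
  exists n; split; [exact (le_trans _ _ _ Hn Hw)|].
  exists m, c; split; [exact Hg|]; exists q; auto.
Qed.

(** If the new indices are bounded by [b], every point of any open set is above
    an element with a new index, hence already in the [b]-th open set.  If they
    are unbounded, their increasing enumeration is a bad sequence. *)
Theorem wqo_alexandroff_noetherian Q le : WQO Q le -> ANoetherian Q le.
Proof.
  intros [HQ HW]; destruct (alexandroff_exists Q le) as (U & k & HA).
  exists U, k; split; [exact HA|split; [exact (alexandroff_space _ _ _ _ HQ HA)|]].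
  intros g Hg Hdec.
  assert (HU : forall q p, <<q, p>> \in U <-> <<q, p>> \in le)
    by (intros; eapply alexandroff_mem; eauto).
  assert (BN : B0 (fun e => NewIndex le g (e 0%nat)))
    by (unfold NewIndex; b0; apply B0_Enumerated; tm).
  destruct (classic (exists b, forall t, NewIndex le g t -> t < b)) as [[b Hb]|Hunb].
  - exists b; apply stabilises; [exact Hdec|]; intros n x _ Hx Hn.
    destruct (delta0_least (fun t => exists q, q <= t /\
      (Enumerated g t q /\ <<q, x>> \in le))) as (t & (q & Hqt & Hq & Hqx) & Hmin).
    + b0; apply B0_Enumerated; tm.
    + destruct (InOpen_Enumerated _ _ _ _ Hn) as (t & q & Ht & Hqx).
      exists t, q; split; [exact (Enumerated_le _ _ _ Ht)|split; [exact Ht|apply HU, Hqx]].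
    + assert (Ht : t < b).
      { apply Hb; exists q; split; [exact Hqt|split; [exact Hq|]].
        intros s Hs p Hp Hsp Hpq; apply (Hmin s Hs); exists p.
        split; [exact Hp|split; [exact Hsp|]].
        exact (proj2 (proj2 HQ) p q x (conj Hpq Hqx)). }
      destruct (Enumerated_InOpen U g t q x Hq (proj2 (HU _ _) Hqx)) as (n' & Hn' & Ho).
      apply (InOpen_mono Q U g n' b x Hdec Hx); [left|exact Ho].
      exact (le_lt_trans _ _ _ Hn' Ht).
  - exfalso.
    destruct (increasing_enumeration (NewIndex le g) BN) as (h & Hh & Hinc).
    { intros b; apply NNPP; intros Hn; apply Hunb; exists b; intros t Ht.
      destruct (lt_or_le t b); [assumption|]; destruct Hn; eauto. }
    destruct (Func_compose (NewIndex le g) (fun q => q \in Q) h (Enumerated g) Hh)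
      as (f & Hf & Hfh).
    + apply B0_Enumerated; tm.
    + intros t (q & _ & Hq & _); exists q; split; [|split; [exact Hq|]].
      * destruct Hq as (w & _ & _ & n & _ & m & _ & c & _ & Hgc & Hin).
        apply (Func_dom _ _ _ _ _ Hg Hgc), Hin.
      * intros q' Hq'; exact (Enumerated_unique _ _ _ _ Hq' Hq).
    + destruct (HW f Hf) as (m & n & Hmn & p & q & Hp & Hq & Hpq).
      apply Hfh in Hp as (s & Hs & Hp); apply Hfh in Hq as (t & Ht & Hq).
      destruct (proj2 (Func_dom _ _ _ _ _ Hh Ht)) as (q' & _ & Hq' & Hnew).
      rewrite (Enumerated_unique _ _ _ _ Hq Hq') in Hpq.
      exact (Hnew s (Hinc _ _ _ _ Hmn Hs Ht) p (Enumerated_le _ _ _ Hp) Hp Hpq).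
Qed.

(** The [n]-th open set consists of the elements above [f m] for some [m <= n];
    when the sequence is constant from [N] on, [f (N + 1)] is above some [f m]
    with [m <= N]. *)
Theorem alexandroff_noetherian_wqo Q le :
  QuasiOrder Q le -> ANoetherian Q le -> WQO Q le.
Proof.
  intros HQ (U & k & HA & _ & HN); split; [exact HQ|intros f Hf].
  assert (HU : forall q p, <<q, p>> \in U <-> <<q, p>> \in le)
    by (intros; eapply alexandroff_mem; eauto).
  destruct (open_code_exists Q (fun n q => exists m, m <= n /\ <<m, q>> \in f))
    as (g & Hg & Ho); [b0| |].
  - intros n q (m & _ & Hm); exact (proj2 (Func_dom _ _ _ _ _ Hf Hm)).
  - destruct (HN g Hg) as [N HNg].
    + intros n x [Hx Hc]; split; [exact Hx|]; intros H; apply Hc.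
      apply Ho in H as (q & (m & Hm & Hq) & Hqx); apply Ho.
      exists q; split; [exists m; split; [|exact Hq]|exact Hqx].
      exact (le_trans _ _ _ Hm (le_add_r _ _)).
    + destruct (proj2 Hf (N + 1) eq_refl) as (q & Hq & _).
      assert (HqQ := proj2 (Func_dom _ _ _ _ _ Hf Hq)).
      assert (H : InOpen U g N q).
      { apply NNPP; intros Hn.
        destruct (proj2 (HNg (N + 1) (lt_succ N) q) (conj HqQ Hn)) as [_ H].
        apply H, Ho; exists q; split; [exists (N + 1); auto|].
        apply HU; apply (proj1 (proj2 HQ)), HqQ. }
      apply Ho in H as (p & (m & Hm & Hp) & Hpq).
      exists m, (N + 1); split; [apply lt_succ_le, Hm|].
      exists p, q; split; [exact Hp|split; [exact Hq|apply HU, Hpq]].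
Qed.

(** Basic open sets of the upper topology are upward closed and decidable.  The
    part of the [n]-th open set that is enumerated from the codes of the first
    [n] sets before stage [n] is therefore decidable, and it is a union of basic
    open sets of the Alexandroff topology.  These parts increase and have the same
    union as the given sequence, so once they are constant, so is the sequence. *)
Theorem alexandroff_upper_noetherian Q le :
  QuasiOrder Q le -> ANoetherian Q le -> UNoetherian Q le.
Proof.
  intros HQ (U & k & HA & _ & HN); destruct (upper_exists Q le) as (I & V & l & HUp).
  exists I, V, l; split; [exact HUp|split; [exact (upper_space _ _ _ _ _ HQ HUp)|]].
  intros g Hg Hdec.
  assert (HU : forall q p, <<q, p>> \in U <-> <<q, p>> \in le)
    by (intros; eapply alexandroff_mem; eauto).
  assert (HV : forall i q, <<i, q>> \in V <-> i \in I /\ q \in Q /\ ~ Down Q le i q)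
    by (intros; eapply upper_mem; eauto).
  assert (Vup : forall i x y, <<i, x>> \in V -> <<x, y>> \in le -> <<i, y>> \in V).
  { intros i x y Hx Hxy; apply HV in Hx as (Hi & Hx & Hd); apply HV.
    destruct (QuasiOrder_dom _ _ _ _ HQ Hxy) as [_ Hy].
    split; [exact Hi|split; [exact Hy|]]; intros [_ (p & Hp & Hyp)]; apply Hd.
    split; [exact Hx|]; exists p; split; [exact Hp|].
    exact (proj2 (proj2 HQ) x y p (conj Hxy Hyp)). }
  destruct (open_code_exists Q
    (fun n x => x \in Q /\ exists n', n' <= n /\ InOpenBy V g n' x n))
    as (g' & Hg' & Ho); [b0; apply B0_InOpenBy; tm|tauto|].
  assert (Hstage : forall n y, y \in Q ->
    InOpen U g' n y <-> exists n', n' <= n /\ InOpenBy V g n' y n).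
  { intros n y Hy; rewrite Ho; split.
    - intros (x & [_ (n' & Hn & m & Hm & c & Hc & Hgc & i & Hi & Hic & Hx)] & Hxy).
      exists n'; split; [exact Hn|]; exists m; split; [exact Hm|].
      exists c; split; [exact Hc|split; [exact Hgc|]].
      exists i; split; [exact Hi|split; [exact Hic|]].
      apply (Vup i x y Hx), HU, Hxy.
    - intros H; exists y; split; [auto|apply HU, (proj1 (proj2 HQ)), Hy]. }
  destruct (HN g' Hg') as [N HNg].
  - intros n x [Hx Hc]; split; [exact Hx|]; intros H; apply Hc.
    apply Hstage in H as (n' & Hn & H); [|exact Hx].
    apply Hstage; [exact Hx|]; exists n'; split; [exact (le_trans _ _ _ Hn (le_add_r _ _))|].
    exact (InOpenBy_mono _ _ _ _ _ _ (le_add_r _ _) H).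
  - exists N; apply stabilises; [exact Hdec|]; intros n x Hn Hx H.
    apply InOpen_stage in H as [w Hw].
    assert (HnW : InOpen U g' (n + w) x).
    { apply Hstage; [exact Hx|]; exists n; split; [apply le_add_r|].
      exact (InOpenBy_mono _ _ _ _ _ _ (le_add_l _ _) Hw). }
    assert (H : InOpen U g' N x).
    { apply NNPP; intros HnN.
      apply (proj2 (proj2 (HNg (n + w) (lt_le_trans _ _ _ Hn (le_add_r _ _)) x)
                     (conj Hx HnN))), HnW. }
    apply Hstage in H as (n' & Hn' & H); [|exact Hx].
    apply (InOpen_mono Q V g n' N x Hdec Hx Hn'), InOpen_stage; eauto.
Qed.

End Spaces.

Theorem proposition3p8 :
  proves RCA0 (sentence (
    ALLS Q le, quasi_order Q le -->
      (A_noetherian Q le --> U_noetherian Q le) /\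
      (wqo Q le <--> A_noetherian Q le))%so).
Proof.
  apply completeness; [exact RCA0_fsubst|]; intros M HM e f.
  pose (RM := {| model_set := f 0%nat; model_RCA0 := HM |} : RCA0_model M).
  assert (H : sat M e f (sentence (
    ALLS Q le, quasi_order Q le -->
      (A_noetherian Q le --> U_noetherian Q le) /\
      (wqo Q le <--> A_noetherian Q le))%so) <->
    forall Q le : sets M, QuasiOrder Q le ->
      (ANoetherian Q le -> UNoetherian Q le) /\ (WQO Q le <-> ANoetherian Q le)).
  { cbv [QuasiOrder ANoetherian UNoetherian WQO Alexandroff Upper Noetherian CscSpace
         Func PFin NatPairs Nats InClosed InOpen Down FinCode FinRep InFin pr].
    unfold_fm; repeat read_form. }
  apply H; intros Q le HQ; split; [|split].
  - apply alexandroff_upper_noetherian, HQ.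
  - apply wqo_alexandroff_noetherian.
  - apply alexandroff_noetherian_wqo, HQ.
Qed.
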